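(* Suppose that for every finite triangulation $T$ of the sphere $S^2$ an oriented edge $(a,b)$ of $T$ and a 2-loop $\Gamma=(\gamma_0,\dots,\gamma_n)$ based at $\gamma_0=\gamma_n=(a,b)$ and sweeping each triangle of $T$ once only have been chosen, and let $\zeta$ be the associated global section (constructed in the context). Then the four-colour theorem (that is, the assertion that $K_T\neq 0$ for every finite triangulation $T$ of $S^2$) is equivalent to the assertion that, for every finite triangulation $T$ of $S^2$, $\zeta_{xy}\neq 0$ for every oriented edge $(xy)$, i.e. that the connection of $\zeta$ vanishes nowhere.
   Context: Triangulation and chromatic index. $T=(T_0,T_1,T_2)$: sets of vertices, (unoriented) edges and triangles. An orientation of $S^2$ is fixed, and $[xyz]$ denotes a positively oriented triangle. $K_T:=\sum_u\prod_{[xyz]} i\,\det(u_{xy},u_{yz},u_{zx})$, where $i=\sqrt{-1}$, $u$ runs over all maps $T_1\to\{e_1,e_2,e_3\}$ (canonical basis of $\mathbb{R}^3$), and the product is over all positively oriented triangles (one factor per triangle). The four-colour theorem is the assertion that $K_T\ne0$ for every finite spherical triangulation $T$ (equivalently, that the faces of every finite spherical polyhedron can be coloured with four colours so that adjacent faces have distinct colours). Edge-paths, 2-paths, 2-loops. An edge-path is a sequence $\gamma=(x_0,\dots,x_\ell)$ of vertices with $\{x_j,x_{j+1}\}\in T_1$ for all $j$. A 2-edge is a pair of edge-paths of the form $\{(x_0,\dots,x_\ell),(x_0,\dots,x_j,y,x_{j+1},\dots,x_\ell)\}$ with $\{x_j,y,x_{j+1}\}\in T_2$; it sweeps the triangle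 $\{x_j,y,x_{j+1}\}$. A 2-path is a sequence $\Gamma=(\gamma_0,\dots,\gamma_n)$ of edge-paths such that each $\{\gamma_p,\gamma_{p+1}\}$ is a 2-edge; it is a 2-loop based at $\gamma_0$ if $\gamma_n=\gamma_0$. It sweeps each triangle once only if each triangle of $T$ is swept by $\{\gamma_p,\gamma_{p+1}\}$ for exactly one $p\in\{0,\dots,n-1\}$. Representation. $V=\mathfrak{sl}_2(\mathbb{C})$ with its adjoint action, basis $e_1,e_2,e_3$ and bracket $[e_a,e_b]=i\,\varepsilon_{abc}e_c$. $I=\mathrm{Id}_V$. For a $V$-module $M$ (finite-dimensional complex representation of $\mathfrak{sl}_2$), $VM$ means $V\otimes M$ and $I_M=\mathrm{Id}_M$. Define the equivariant maps $\widetilde F:V\otimes V\to V$, $\widetilde F(e_a\otimes e_b)=i\,\varepsilon_{abc}e_c$, and $F:V\to V\otimes V$, $F(e_a)=i\,e_{a-1}\wedge e_{a+1}$, with indices modulo 3 and $u\wedge v=u\otimes v-v\otimes u$ (so $\widetilde FF=2I$). Sections over paths. A section $\zeta$ over an edge-path $\alpha=(a_0,\dots,a_\ell)$ consists of $V$-modules $\zeta_{a_0},\dots,\zeta_{a_\ell}$ (one for each position in the path) and intertwiners $\zeta_{a_ja_{j-1}}:\zeta_{a_{j-1}}\to V\zeta_{a_j}$ and $\zeta_{a_{j-1}a_j}:V\zeta_{a_j}\to\zeta_{a_{j-1}}$ for $1\le j\le\ell$. Local moves. For an ordered 2-edge $(\alpha,\beta)$, $\Phi_{\alpha\beta}$ maps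 sections over $\beta$ to sections over $\alpha$; it acts as follows on the part of the path where $\alpha$ and $\beta$ differ, leaving all other modules and arrows unchanged. (1) If $\beta$ contains $(x,y,z)$ where $\alpha$ has $(x,z)$, a section $\zeta$ over $\beta$ is sent to $\xi$ with $\xi_x=\zeta_x$, $\xi_z=\zeta_z$, $\xi_{zx}=(\widetilde F\otimes I_{\zeta_z})\circ(I\otimes\zeta_{zy})\circ\zeta_{yx}$, $\xi_{xz}=\zeta_{xy}\circ(I\otimes\zeta_{yz})\circ(F\otimes I_{\zeta_z})$. (2) If $\beta$ contains $(x,z)$ where $\alpha$ has $(x,y,z)$, a section $\xi$ over $\beta$ is sent to $\zeta$ with $\zeta_x=\xi_x$, $\zeta_y=V\xi_z$, $\zeta_z=\xi_z$, $\zeta_{yx}=(F\otimes I_{\xi_z})\circ\xi_{zx}$, $\zeta_{xy}=\xi_{xz}\circ(\widetilde F\otimes I_{\xi_z})$, $\zeta_{yz}=\zeta_{zy}=I\otimes I_{\xi_z}$. The global section $\zeta$. Let $\zeta^n$ be the section over $\gamma_n=(a,b)$ with $\zeta^n_a=\zeta^n_b=V$, $\zeta^n_{ba}=F:V\to V\otimes V$, $\zeta^n_{ab}=\widetilde F:V\otimes V\to V$. For $p=n-1,\dots,0$ put $\zeta^p=\Phi_{\gamma_p\gamma_{p+1}}(\zeta^{p+1})$, a section over $\gamma_p$. Since a local move leaves unchanged the arrows on the edges it does not touch, the sections $\zeta^n,\zeta^{n-1},\dots,\zeta^0$ glue to a global section $\zeta$ over the lift $\widetilde T$ of $T$ to a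 triangulation of the disk $D^2$ whose boundary consists of two arcs, both projecting onto the base edge $(ab)$ (one carries the values of $\zeta^n$, the other those of $\zeta^0$). The arrows $\zeta_{xy}$ of $\zeta$ are exactly all the arrows, in both directions along every edge, occurring in the sections $\zeta^p$, $0\le p\le n$. The condition ''$\zeta_{xy}\ne0$ for all $(xy)$'' means that all of these arrows are nonzero linear maps. *)

(* Defs.v *)
From HB Require Import structures.
From mathcomp Require Import all_boot all_order all_algebra.
From mathcomp Require Import all_classical all_reals all_analysis.
From mathcomp Require Import complex ring.

Set Implicit Arguments.
Unset Strict Implicit.
Unset Printing Implicit Defensive.

Import Order.TTheory GRing.Theory Num.Theory.
Import numFieldNormedType.Exports.

Local Open Scope ring_scope.

Section Sl2.
Variable C : numClosedFieldType.
Local Notation V := 'rV[C]_3.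

(* 'I_3 is Z/3, so the index of e_3 is 0: indices are only used modulo 3. *)
Definition eps (a b c : 'I_3) : C :=
  if (b == a + 1) && (c == a + 2%:R) then 1
  else if (b == a + 2%:R) && (c == a + 1) then -1 else 0.

(* V = sl_2(C) in coordinates on the basis e_1, e_2, e_3 (for instance, halves
   of the Pauli matrices), with [e_a, e_b] = i eps_abc e_c. *)
Definition e (a : 'I_3) : V := delta_mx 0 a.

Definition br (x y : V) : V :=
  \sum_a \sum_b \sum_c (x 0 a * y 0 b * ('i * eps a b c)) *: e c.

Record module := Module {
  space :> vectType C;
  act : V -> 'End(space);
  act_linear : linear act;
  act_br : forall x y m, act (br x y) m = act x (act y m) - act y (act x m) }.

Arguments space : simpl never.
Arguments act : simpl never.

Record hom (M N : module) := Hom {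
  map_of :> 'Hom(M, N);
  map_act : forall x m, map_of (act M x m) = act N x (map_of m) }.

Lemma sub_cross (G : zmodType) (A B E F P Q : G) :
  (A - B) + (E - F) = (A + P + (Q + E)) - (B + Q + (P + F)).
Proof.
rewrite (addrC Q E) (addrC P F) (addrACA A P) (addrACA B Q) (addrC Q P).
by rewrite [- (B + F + _)]opprD [RHS]addrACA subrr addr0 [- (B + F)]opprD addrACA.
Qed.

Lemma sum3 (G : nmodType) (f : 'I_3 -> G) : \sum_a f a = f 0 + (f 1 + f 2%:R).
Proof.
rewrite !big_ord_recl big_ord0 addr0.
by congr (_ + (f _ + f _)); apply/val_inj.
Qed.

Lemma ord3 (P : 'I_3 -> Prop) : P 0 -> P 1 -> P 2%:R -> forall a, P a.
Proof.
move=> h0 h1 h2; case=> [[|[|[|//]]] h].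
- by rewrite (_ : Ordinal h = 0) //; apply/val_inj.
- by rewrite (_ : Ordinal h = 1) //; apply/val_inj.
- by rewrite (_ : Ordinal h = 2%:R) //; apply/val_inj.
Qed.

Lemma add3E : (((1 + 2%:R)%R = 0 :> 'I_3) * ((2%:R + 2%:R)%R = 1%R :> 'I_3)
  * ((2%:R + 1)%R = 0%R :> 'I_3) * ((1 + 1)%R = 2%:R :> 'I_3))%type.
Proof. by do !split; apply/val_inj. Qed.

Lemma brE x y c :
  br x y 0 c = 'i * (x 0 (c + 1) * y 0 (c + 2%:R) - x 0 (c + 2%:R) * y 0 (c + 1)).
Proof.
rewrite /br !sum3 !mxE /eps.
by move: c; apply: ord3; rewrite ?add0r ?add3E /=; ring.
Qed.

Lemma eE a b : e a 0 b = (b == a)%:R.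
Proof. by rewrite mxE eqxx. Qed.

Lemma e_sum (x : V) : x = \sum_a x 0 a *: e a.
Proof. exact: row_sum_delta. Qed.

Lemma br_linearl y : linear (br^~ y).
Proof. by move=> k x x'; apply/rowP=> c; rewrite !(brE, mxE); ring. Qed.

Lemma br_linearr x : linear (br x).
Proof. by move=> k y y'; apply/rowP=> c; rewrite !(brE, mxE); ring. Qed.

Definition ad (x : V) : 'End(V) := linfun (br x).
HB.instance Definition _ x := GRing.isLinear.Build C V V _ (br x) (br_linearr x).

Lemma ad_linear : linear ad.
Proof.
move=> k x y; apply/lfunP=> z; rewrite add_lfunE scale_lfunE !lfunE /=. rewrite br_linearl.
by [].
Qed.

Lemma ad_br x y z : ad (br x y) z = ad x (ad y z) - ad y (ad x z).
Proof.
rewrite !lfunE /=; apply/rowP=> c; rewrite !(brE, mxE).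
by move: c; apply: ord3; rewrite ?add0r ?add3E ?add0r; ring.
Qed.

Lemma br_jacobi x u v : br (br x u) v + br u (br x v) = br x (br u v).
Proof.
apply/rowP=> c; rewrite !(brE, mxE).
by move: c; apply: ord3; rewrite ?add0r ?add3E ?add0r; ring.
Qed.

Definition adj : module := Module ad_linear ad_br.

Lemma adjE x (v : adj) : act adj x v = br x v.
Proof. exact: lfunE. Qed.

(* V (x) M is represented by {ffun 'I_3 -> M}: the family (w_a) stands for
   sum_a e_a (x) w_a. *)
Section Tensor.
Variable M : module.
Local Notation VM := {ffun 'I_3 -> M}.

Definition tens (v : V) (m : M) : VM := [ffun a => v 0 a *: m].

Lemma tens_linearl m : linear (tens^~ m).
Proof. by move=> k u v; apply/ffunP=> a; rewrite !ffunE !mxE scalerDl scalerA. Qed.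

Lemma tens_linearr v : linear (tens v).
Proof.
by move=> k m n; apply/ffunP=> a; rewrite !ffunE scalerDr !scalerA mulrC.
Qed.

Lemma tens_sum (w : VM) : w = \sum_a tens (e a) (w a).
Proof.
apply/ffunP=> b; rewrite sum_ffunE (bigD1 b) //= big1 ?addr0 => [|a nab].
  by rewrite ffunE mxE !eqxx scale1r.
by rewrite ffunE mxE eqxx eq_sym (negPf nab) scale0r.
Qed.

Lemma tensDl u v m : tens (u + v) m = tens u m + tens v m.
Proof. by have := tens_linearl m 1 u v; rewrite !scale1r. Qed.
Lemma tensZl k v m : tens (k *: v) m = k *: tens v m.
Proof. by apply/ffunP=> a; rewrite !ffunE mxE scalerA. Qed.
Lemma tensDr v m n : tens v (m + n) = tens v m + tens v n.
Proof. by have := tens_linearr v 1 m n; rewrite !scale1r. Qed.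
Lemma tensZr k v m : tens v (k *: m) = k *: tens v m.
Proof. by apply/ffunP=> a; rewrite !ffunE !scalerA mulrC. Qed.

Lemma tensNl v m : tens (- v) m = - tens v m.
Proof. by apply/ffunP=> a; rewrite !ffunE mxE scaleNr. Qed.
Lemma tensNr v m : tens v (- m) = - tens v m.
Proof. by apply/ffunP=> a; rewrite !ffunE scalerN. Qed.

Lemma tens_suml (f : 'I_3 -> V) m : tens (\sum_a f a) m = \sum_a tens (f a) m.
Proof.
apply: (big_morph (tens^~ m)) => [u v|]; first exact: tensDl.
by apply/ffunP=> a; rewrite !ffunE mxE scale0r.
Qed.

(* The action of x on sum_a e_a (x) w_a, by the Leibniz rule. *)
Definition tact_fun (x : V) (w : VM) : VM :=
  \sum_a (tens (br x (e a)) (w a) + tens (e a) (act M x (w a))).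

Lemma tact_fun_linear x : linear (tact_fun x).
Proof.
move=> k w w'; rewrite /tact_fun scaler_sumr -big_split /=; apply: eq_bigr => a _.
by rewrite !ffunE linearP !tensDr !tensZr scalerDr addrACA.
Qed.
HB.instance Definition _ x :=
  GRing.isLinear.Build C VM VM _ (tact_fun x) (tact_fun_linear x).

Lemma tact_fun_tens x v m :
  tact_fun x (tens v m) = tens (br x v) m + tens v (act M x m).
Proof.
rewrite /tact_fun big_split /=; congr (_ + _).
  rewrite {2}[v]e_sum linear_sum /=.
  by rewrite tens_suml; apply: eq_bigr => a _; rewrite ffunE linearZ /= tensZl tensZr.
rewrite [RHS]tens_sum; apply: eq_bigr => a _.
by rewrite !ffunE linearZ.
Qed.

Definition tact (x : V) : 'End(VM) := linfun (tact_fun x).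

Lemma tact_linear : linear tact.
Proof.
move=> k x y; apply/lfunP=> w; rewrite add_lfunE scale_lfunE !lfunE /=.
rewrite /tact_fun scaler_sumr -big_split /=; apply: eq_bigr => a _.
rewrite br_linearl act_linear add_lfunE scale_lfunE.
by rewrite tensDl tensZl tensDr tensZr scalerDr addrACA.
Qed.

Lemma tact_br x y w : tact (br x y) w = tact x (tact y w) - tact y (tact x w).
Proof.
rewrite [w]tens_sum !linear_sum -big_split /=; apply: eq_bigr => a _.
rewrite !lfunE /= !tact_fun_tens !linearD /= !tact_fun_tens act_br.
have := ad_br x y (e a); rewrite !lfunE /= => ->.
rewrite tensDl tensDr tensNl tensNr.
rewrite -[X in _ = _ + X]opprD; exact: sub_cross.
Qed.

Definition tensor : module := Module tact_linear tact_br.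

Lemma tensor_act x v m : act tensor x (tens v m) = tens (br x v) m + tens v (act M x m).
Proof. by rewrite lfunE /= tact_fun_tens. Qed.

End Tensor.

Lemma hom_ext_tens (M : module) (W : vectType C) (f g : 'Hom(tensor M, W)) :
  (forall v (m : M), f (tens v m) = g (tens v m)) -> f = g.
Proof.
move=> h; apply/lfunP=> w; rewrite [w]tens_sum !linear_sum.
by apply: eq_bigr => a _; apply: h.
Qed.

Lemma hom_ext_tens2 (M : module) (W : vectType C) (f g : 'Hom(tensor (tensor M), W)) :
  (forall u v (m : M), f (tens u (tens v m : tensor M)) = g (tens u (tens v m : tensor M))) -> f = g.
Proof.
move=> h; apply: hom_ext_tens => u w.
have tsum : tens u w = \sum_a tens (M := tensor M) u (tens (e a) (w a)).
  rewrite {1}[w]tens_sum; apply: (big_morph (tens u)) => [m n|]; first exact: tensDr.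
  by apply/ffunP=> a; rewrite !ffunE scaler0.
by rewrite tsum !linear_sum; apply: eq_bigr => a _; apply: h.
Qed.

Section Maps.
Variable M : module.

(* I (x) f, for f : M -> N *)
Definition idt_fun (N : module) (f : hom M N) (w : tensor M) : tensor N :=
  [ffun a => f (w a)].

Lemma idt_fun_linear N (f : hom M N) : linear (idt_fun f).
Proof. by move=> k w w'; apply/ffunP=> a; rewrite !ffunE linearP. Qed.
HB.instance Definition _ N f := GRing.isLinear.Build C (tensor M) (tensor N) _
  (@idt_fun N f) (idt_fun_linear f).

Lemma idt_tens N (f : hom M N) v m : idt_fun f (tens v m) = tens v (f m).
Proof. by apply/ffunP=> a; rewrite !ffunE linearZ. Qed.

Lemma idtE N (f : hom M N) v m : linfun (idt_fun f) (tens v m) = tens v (f m).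
Proof. by rewrite lfunE /= idt_tens. Qed.

Lemma idt_act N (f : hom M N) x w :
  linfun (idt_fun f) (act (tensor M) x w) = act (tensor N) x (linfun (idt_fun f) w).
Proof.
rewrite -!comp_lfunE; congr (fun_of_lfun _ w); apply: hom_ext_tens => v m.
rewrite !comp_lfunE tensor_act linearD /= !idtE tensor_act.
by rewrite map_act.
Qed.

Definition idt N f : hom (tensor M) (tensor N) := Hom (@idt_act N f).

End Maps.

Notation VV := (tensor adj).

(* The linear map V (x) V -> V with e_a (x) e_b |-> i eps_abc e_c. *)
Definition Ft_fun (w : VV) : V :=
  \sum_a \sum_b \sum_c (w a 0 b * ('i * eps a b c)) *: e c.

Lemma Ft_tens u v : Ft_fun (tens (u : adj) (v : adj)) = br u v.
Proof.
by do 3 (apply: eq_bigr => ? _); rewrite ffunE mxE.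
Qed.

Lemma Ft_linear : linear Ft_fun.
Proof.
move=> k w w'; rewrite /Ft_fun.
do 3 (rewrite scaler_sumr -big_split /=; apply: eq_bigr => ? _).
by rewrite !ffunE !mxE scalerA -scalerDl; congr (_ *: _); ring.
Qed.
HB.instance Definition _ := GRing.isLinear.Build C VV adj _ Ft_fun Ft_linear.

Lemma FtE u v : linfun Ft_fun (tens (u : adj) (v : adj)) = br u v.
Proof. by rewrite lfunE /= Ft_tens. Qed.

Lemma Ft_act x w : linfun Ft_fun (act VV x w) = act adj x (linfun Ft_fun w).
Proof.
rewrite -!comp_lfunE; congr (fun_of_lfun _ w); apply: hom_ext_tens => u v.
rewrite !comp_lfunE tensor_act linearD /= !FtE !lfunE /=.
by rewrite br_jacobi.
Qed.

Definition Ft : hom VV adj := @Hom VV adj (linfun Ft_fun) Ft_act.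

Definition wedge (u v : adj) : VV := tens u v - tens v u.
(* The linear map V -> V (x) V with e_a |-> i e_{a-1} /\ e_{a+1}. *)
Definition F_fun (v : adj) : VV :=
  \sum_a v 0 a *: ('i *: wedge (e (a - 1)) (e (a + 1))).

Lemma F_linear : linear F_fun.
Proof.
move=> k u v; rewrite /F_fun scaler_sumr -big_split /=; apply: eq_bigr => a _.
by rewrite !mxE scalerDl !scalerA.
Qed.
HB.instance Definition _ := GRing.isLinear.Build C adj VV _ F_fun F_linear.

Lemma subr1_3 (a : 'I_3) : a - 1 = a + 2%:R.
Proof. by move: a; apply: ord3; apply/val_inj. Qed.

Lemma wedge_coord u v a b : wedge u v a 0 b = u 0 a * v 0 b - v 0 a * u 0 b.
Proof. by rewrite /wedge !ffunE !mxE. Qed.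

Lemma F_coord v a b : F_fun v a 0 b = - ('i * \sum_c v 0 c * eps a b c).
Proof.
have -> : F_fun v a 0 b = \sum_c v 0 c * ('i *
    (e (c - 1) 0 a * e (c + 1) 0 b - e (c + 1) 0 a * e (c - 1) 0 b)).
  rewrite /F_fun sum_ffunE summxE; apply: eq_bigr => c _.
  by rewrite -wedge_coord !ffunE !mxE.
rewrite !sum3 !subr1_3 !eE /eps.
by move: a; apply: ord3; move: b; apply: ord3; rewrite ?add0r ?add3E /=; ring.
Qed.

Lemma VV_act_coord x (w : VV) a b :
  act VV x w a 0 b = \sum_c br x (e c) 0 a * w c 0 b + br x (w a) 0 b.
Proof.
rewrite lfunE /= /tact_fun big_split /= ffunE mxE.
congr (_ + _).
  by rewrite sum_ffunE summxE; apply: eq_bigr => c _; rewrite ffunE mxE.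
rewrite sum_ffunE summxE (bigD1 a) //= big1 ?addr0 => [|c nca].
  by rewrite ffunE mxE lfunE /= !mxE !eqxx mul1r.
by rewrite ffunE !mxE eqxx eq_sym (negPf nca) mul0r.
Qed.

Lemma F_act x v : linfun F_fun (act adj x v) = act VV x (linfun F_fun v).
Proof.
apply/ffunP=> a; apply/rowP=> b; rewrite VV_act_coord !lfunE /=.
rewrite !sum3 !F_coord !sum3 !brE !F_coord !sum3 !eE /eps.
by move: a; apply: ord3; move: b; apply: ord3; rewrite ?add0r ?add3E /=; ring.
Qed.

Definition F : hom adj VV := @Hom adj VV (linfun F_fun) F_act.

Lemma FtF v : Ft (F v) = 2%:R *: v.
Proof.
have trip (a b : 'I_3) (k : V) c :
    (\sum_d (k 0 b * ('i * eps a b d)) *: e d) 0 c = k 0 b * ('i * eps a b c).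
  rewrite summxE (bigD1 c) //= big1 ?addr0 => [|d nd].
    by rewrite mxE eE eqxx mulr1.
  by rewrite mxE eE eq_sym (negPf nd) mulr0.
rewrite !lfunE /=; apply/rowP=> c; rewrite /Ft_fun summxE [RHS]mxE.
under eq_bigr => a _ do (rewrite summxE; under eq_bigr => b _ do
  (rewrite trip F_coord)).
rewrite !sum3 /eps; have := sqrCi C; rewrite expr2 => ii.
by move: c; apply: ord3; rewrite ?add0r ?add3E /=; ring: ii.
Qed.

Section Maps2.
Variable M : module.

(* For t in V (x) V, t (x) m in V (x) V (x) M. *)
Definition tens2 (t : VV) (m : M) : tensor (tensor M) := [ffun a => tens (t a) m].

Lemma tens2_tens (u v : adj) (m : M) :
  tens2 (tens u v) m = tens (M := tensor M) u (tens v m).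
Proof. by apply/ffunP=> a; rewrite !ffunE tensZl. Qed.

Lemma tens2D s t m : tens2 (s + t) m = tens2 s m + tens2 t m.
Proof. by apply/ffunP=> a; rewrite !ffunE tensDl. Qed.

Lemma tens2Z k t m : tens2 (k *: t) m = k *: tens2 t m.
Proof. by apply/ffunP=> a; rewrite !ffunE tensZl. Qed.

Lemma tens2_suml (f : 'I_3 -> VV) m : tens2 (\sum_a f a) m = \sum_a tens2 (f a) m.
Proof.
apply: (big_morph (tens2^~ m)) => [s t|]; first exact: tens2D.
by apply/ffunP=> a; apply/ffunP=> b; rewrite !ffunE mxE scale0r.
Qed.

Lemma tens2_act x t m : act (tensor (tensor M)) x (tens2 t m) =
  tens2 (act VV x t) m + tens2 t (act M x m).
Proof.
rewrite [t]tens_sum !(tens2_suml, linear_sum) -big_split; apply: eq_bigr => a _.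
rewrite /= !tens2_tens !tensor_act tens2D !tens2_tens lfunE /=.
by rewrite tensDr addrA.
Qed.

(* F (x) I_M *)
Definition FI_fun (w : tensor M) : tensor (tensor M) :=
  \sum_a tens2 (F (e a)) (w a).

Lemma FI_linear : linear FI_fun.
Proof.
move=> k w w'; rewrite /FI_fun scaler_sumr -big_split /=; apply: eq_bigr => a _.
by rewrite !ffunE; apply/ffunP=> b; rewrite !ffunE tensDr tensZr.
Qed.
HB.instance Definition _ :=
  GRing.isLinear.Build C (tensor M) (tensor (tensor M)) _ FI_fun FI_linear.

Lemma FI_tens v m : linfun FI_fun (tens v m) = tens2 (F v) m.
Proof.
rewrite lfunE /= /FI_fun {2}[v]e_sum linear_sum tens2_suml.
apply: eq_bigr => a _; rewrite linearZ /= tens2Z ffunE.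
by apply/ffunP=> b; rewrite !ffunE tensZr.
Qed.

Lemma FI_act x w :
  linfun FI_fun (act (tensor M) x w) = act (tensor (tensor M)) x (linfun FI_fun w).
Proof.
rewrite -!comp_lfunE; congr (fun_of_lfun _ w); apply: hom_ext_tens => v m.
rewrite !comp_lfunE tensor_act linearD /= !FI_tens tens2_act.
by rewrite -(map_act F x v) adjE.
Qed.

Definition FI : hom (tensor M) (tensor (tensor M)) :=
  @Hom (tensor M) (tensor (tensor M)) (linfun FI_fun) FI_act.

(* Ft (x) I_M *)
Definition FtI_fun (w : tensor (tensor M)) : tensor M :=
  \sum_a \sum_b tens (Ft (tens (e a : adj) (e b : adj))) (w a b).

Lemma FtI_linear : linear FtI_fun.
Proof.
move=> k w w'; rewrite /FtI_fun.
do 2 (rewrite scaler_sumr -big_split /=; apply: eq_bigr => ? _).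
by rewrite !ffunE tensDr tensZr.
Qed.
HB.instance Definition _ :=
  GRing.isLinear.Build C (tensor (tensor M)) (tensor M) _ FtI_fun FtI_linear.

Lemma FtI_tens u v (m : M) :
  linfun FtI_fun (tens (M := tensor M) u (tens v m)) = tens (br u v) m.
Proof.
rewrite lfunE /= /FtI_fun.
have brl (f : 'I_3 -> V) y : br (\sum_a f a) y = \sum_a br (f a) y.
  apply: (big_morph (br^~ y)) => [s s'|]; last first.
    by apply/rowP=> c; rewrite !(brE, mxE) !mul0r subrr mulr0.
  by have := br_linearl y 1 s s'; rewrite !scale1r.
rewrite {2}[u]e_sum brl tens_suml; apply: eq_bigr => a _.
rewrite {2}[v]e_sum linear_sum tens_suml /=; apply: eq_bigr => b _.
have -> : br (u 0 a *: e a) (v 0 b *: e b) = (u 0 a * v 0 b) *: br (e a) (e b).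
  by apply/rowP=> c; rewrite !(brE, mxE); ring.
by rewrite FtE !ffunE tensZl scalerA tensZr.
Qed.

Lemma FtI_act x w :
  linfun FtI_fun (act (tensor (tensor M)) x w) = act (tensor M) x (linfun FtI_fun w).
Proof.
rewrite -!comp_lfunE; congr (fun_of_lfun _ w); apply: hom_ext_tens2 => u v m.
rewrite !comp_lfunE !tensor_act tensDr !linearD /= !FtI_tens tensor_act.
by rewrite -(br_jacobi x u v) tensDl addrA.
Qed.

Definition FtI : hom (tensor (tensor M)) (tensor M) :=
  @Hom (tensor (tensor M)) (tensor M) (linfun FtI_fun) FtI_act.
End Maps2.

Lemma hid_act (M : module) x (m : M) :
  (\1%VF : 'End(M)) (act M x m) = act M x ((\1%VF : 'End(M)) m).
Proof. by rewrite !id_lfunE. Qed.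
Definition hid (M : module) : hom M M := Hom (@hid_act M).

Lemma hcomp_act (M N P : module) (g : hom N P) (f : hom M N) x m :
  (g \o f)%VF (act M x m) = act P x ((g \o f)%VF m).
Proof. by rewrite !comp_lfunE !map_act. Qed.
Definition hcomp (M N P : module) (g : hom N P) (f : hom M N) : hom M P :=
  Hom (hcomp_act g f).

End Sl2.

Section Paths.
Variable C : numClosedFieldType.
Local Notation module := (module C).

(* Sections over an edge-path (a_0, ..., a_l), indexed by the module at a_0.
   [Step dn up s] has M = zeta_{a_0}, N = zeta_{a_1}, dn = zeta_{a_1 a_0},
   up = zeta_{a_0 a_1}, and s is the section over (a_1, ..., a_l). *)
Inductive psection : module -> Type :=
| Stop (M : module) : psection M
| Step (M N : module) (dn : hom M (tensor N)) (up : hom (tensor N) M)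
    (s : psection N) : psection M.

(* From sections over (x, y, z, ...) to sections over (x, z, ...). *)
Definition contract (M : module) (s : psection M) : psection M :=
  match s in psection M return psection M with
  | Stop M => Stop M
  | @Step M N dn up s' =>
    match s' in psection N
      return hom M (tensor N) -> hom (tensor N) M -> psection M with
    | Stop N => fun dn up => Step dn up (Stop N)
    | @Step N P dn' up' s'' => fun dn up =>
        Step (hcomp (FtI P) (hcomp (idt dn') dn))
             (hcomp up (hcomp (idt up') (FI P))) s''
    end dn up
  end.

(* From sections over (x, z, ...) to sections over (x, y, z, ...). *)
Definition expand (M : module) (s : psection M) : psection M :=
  match s in psection M return psection M with
  | Stop M => Stop M
  | @Step M P dn up s' =>
      Step (hcomp (FI P) dn) (hcomp up (FtI P))
        (Step (hid (tensor P)) (hid (tensor P)) s')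
  end.

(* Apply f to the part of the section starting at position j of the path. *)
Fixpoint modify_at (f : forall M, psection M -> psection M) (j : nat)
    (M : module) (s : psection M) : psection M :=
  match j, s in psection M return psection M with
  | 0, s => f _ s
  | j'.+1, Stop M => Stop M
  | j'.+1, @Step M N dn up s' => Step dn up (modify_at f j' s')
  end.

Fixpoint nonvanishing (M : module) (s : psection M) : Prop :=
  match s with
  | Stop _ => True
  | @Step M N dn up s' =>
      (dn : 'Hom(M, tensor N)) <> 0 /\ (up : 'Hom(tensor N, M)) <> 0
      /\ nonvanishing s'
  end.

(* The length l of the underlying path (a_0, ..., a_l). *)
Fixpoint plength (M : module) (s : psection M) : nat :=
  match s with Stop _ => 0%N | @Step _ _ _ _ s' => (plength s').+1 end.

Fixpoint common_prefix (X : eqType) (s t : seq X) : nat :=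
  match s, t with
  | x :: s', y :: t' => if x == y then (common_prefix s' t').+1 else 0%N
  | _, _ => 0%N
  end.

(* The local move from sections over beta to sections over alpha, for paths
   alpha, beta which differ by a vertex y present only in one of them, between
   x and z; they first differ just after x (see Phi_contract and Phi_expand). *)
Definition Phi (X : eqType) (alpha beta : seq X) (M : module)
    (s : psection M) : psection M :=
  modify_at (if (size alpha < size beta)%N then contract else expand)
    (common_prefix alpha beta).-1 s.

Lemma common_prefix_ins (X : eqType) (p q : seq X) (x y z : X) : z != y ->
  (common_prefix (p ++ [:: x, z & q]) (p ++ [:: x, y, z & q])).-1 = size p /\
  (common_prefix (p ++ [:: x, y, z & q]) (p ++ [:: x, z & q])).-1 = size p.
Proof.
move=> zy; have yz : y != z by rewrite eq_sym.
suff h : (common_prefix (p ++ [:: x, z & q]) (p ++ [:: x, y, z & q])) = (size p).+1 /\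
  (common_prefix (p ++ [:: x, y, z & q]) (p ++ [:: x, z & q])) = (size p).+1.
  by case: h => -> ->.
elim: p => [|a p [IH1 IH2]] /=; first by rewrite !eqxx (negPf zy) (negPf yz).
by rewrite !eqxx IH1 IH2.
Qed.

Lemma Phi_contract (X : eqType) (p q : seq X) (x y z : X) M (s : psection M) :
  z != y -> Phi (p ++ [:: x, z & q]) (p ++ [:: x, y, z & q]) s =
            modify_at contract (size p) s.
Proof.
move=> zy; rewrite /Phi (common_prefix_ins p q x zy).1 !size_cat /=.
by rewrite ltn_add2l ltnSn.
Qed.

Lemma Phi_expand (X : eqType) (p q : seq X) (x y z : X) M (s : psection M) :
  z != y -> Phi (p ++ [:: x, y, z & q]) (p ++ [:: x, z & q]) s =
            modify_at expand (size p) s.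
Proof.
move=> zy; rewrite /Phi (common_prefix_ins p q x zy).2 !size_cat /=.
by rewrite ltn_add2l ltnNge leqnSn.
Qed.

Lemma plength_contract j M (s : psection M) : (j.+1 < plength s)%N ->
  plength (modify_at contract j s) = (plength s).-1.
Proof.
elim: s j => [//|{}M N dn up s IH] [|j] /=.
  by case: s dn up {IH} => // N' P dn' up' s'.
by move=> h; rewrite IH //; case: (plength s) h.
Qed.

Lemma plength_expand j M (s : psection M) : (j < plength s)%N ->
  plength (modify_at expand j s) = (plength s).+1.
Proof.
by elim: s j => [//|{}M N dn up s IH] [|j] //= h; rewrite IH.
Qed.

Definition base_section : psection (adj C) := Step (F C) (Ft C) (Stop (adj C)).

(* base_section is zeta^n, and zeta_rec [:: gamma_p; ...; gamma_n] is zeta^p. *)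
Fixpoint zeta_rec (X : eqType) (Gamma : seq (seq X)) : psection (adj C) :=
  match Gamma with
  | alpha :: Gamma' =>
      if Gamma' is beta :: _ then Phi alpha beta (zeta_rec Gamma')
      else base_section
  | [::] => base_section
  end.

Definition zeta (X : eqType) (Gamma : seq (seq X)) (p : nat) :
    psection (adj C) := zeta_rec (drop p Gamma).

End Paths.

Section Triangulations.
Variable R : realType.
Local Notation C := R[i].

Definition homeomorphic (X Y : topologicalType) (A : set X) (B : set Y) : Prop :=
  exists (f : X -> Y) (g : Y -> X),
    [/\ {within A, continuous f}%classic, {within B, continuous g}%classic,
        forall x, A x -> B (f x) /\ g (f x) = x
      & forall y, B y -> A (g y) /\ f (g y) = y].

Definition unit_sphere : set 'rV[R]_3 :=
  fun x => \sum_k x 0 k ^+ 2 = 1.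

Section Realization.
Variables (X : finType) (T1 T2 : {set {set X}}).

Definition is_simplex (s : {set X}) : bool :=
  [|| #|s| == 1%N, s \in T1 | s \in T2].

Definition support (x : 'rV[R]_#|X|) : {set X} :=
  [set v | x 0 (enum_rank v) != 0].

(* Barycentric coordinates: x 0 (enum_rank v) is the weight of the vertex v. *)
Definition realization : set 'rV[R]_#|X| :=
  fun x => [/\ forall i, 0 <= x 0 i, \sum_i x 0 i = 1 & is_simplex (support x)].
End Realization.

(* A finite triangulation of the oriented sphere: an abstract simplicial complex
   whose vertices are all of [vertex], with realization homeomorphic to S^2.
   [positive x y z] means that [xyz] is a positively oriented triangle. The
   orientation chooses one of the two cyclic orders on each triangle, in such a
   way that distinct triangles induce opposite orientations on a common edge. *)
Record triangulation := Triangulation {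
  vertex : finType;
  edges : {set {set vertex}};
  triangles : {set {set vertex}};
  card_edge : forall s, s \in edges -> #|s| = 2%N;
  card_triangle : forall s, s \in triangles -> #|s| = 3%N;
  face_closed : forall s t : {set vertex},
    t \in triangles -> s \subset t -> #|s| = 2%N -> s \in edges;
  is_sphere : homeomorphic (realization edges triangles) unit_sphere;
  positive : vertex -> vertex -> vertex -> bool;
  positive_triangle : forall x y z, positive x y z -> [set x; y; z] \in triangles;
  positive_cyclic : forall x y z, positive x y z -> positive y z x;
  positive_alt : forall x y z, [set x; y; z] \in triangles ->
    positive x y z = ~~ positive x z y;
  positive_coherent : forall x y z w,
    positive x y z -> positive x y w -> z = w }.

Section ChromaticIndex.
Variable T : triangulation.

Definition edge : finType := {s : {set vertex T} | s \in edges T}.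

(* The vector u_{xy}; the default 0 is never used for an edge {x, y}. *)
Definition edge_vec (u : {ffun edge -> 'I_3}) (x y : vertex T) : 'rV[C]_3 :=
  oapp (fun s : edge => e C (u s)) 0 (insub [set x; y]).

Definition triangle_factor (u : {ffun edge -> 'I_3}) (x y z : vertex T) : C :=
  'i * \det (\matrix_(k < 3)
    tnth [tuple edge_vec u x y; edge_vec u y z; edge_vec u z x] k).

(* K_T. Every triangle has exactly three positive orderings, cyclic
   permutations of each other, and they all have the same triangle_factor. *)
Definition chromatic_index : C :=
  \sum_(u : {ffun edge -> 'I_3}) \prod_(t in triangles T)
    if [pick p : vertex T * vertex T * vertex T |
          positive p.1.1 p.1.2 p.2 && ([set p.1.1; p.1.2; p.2] == t)] is Some p
    then triangle_factor u p.1.1 p.1.2 p.2 else 1.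
End ChromaticIndex.

Section TwoPaths.
Variable T : triangulation.
Implicit Types (alpha beta : seq (vertex T)) (t : {set vertex T}).

Definition edge_path alpha : bool :=
  (alpha != [::]) && sorted (fun x y => [set x; y] \in edges T) alpha.

Definition inserts alpha beta t : Prop :=
  exists p x y z q, [/\ alpha = p ++ [:: x, z & q], beta = p ++ [:: x, y, z & q],
    t = [set x; y; z] & t \in triangles T].

(* {alpha, beta} is a 2-edge which sweeps t. *)
Definition sweeps alpha beta t : Prop :=
  [/\ edge_path alpha, edge_path beta & inserts alpha beta t \/ inserts beta alpha t].

Definition two_path (Gamma : seq (seq (vertex T))) : Prop :=
  [/\ Gamma <> [::], forall p, (p < size Gamma)%N -> edge_path (nth [::] Gamma p)
    & forall p, (p.+1 < size Gamma)%N ->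
        exists t, sweeps (nth [::] Gamma p) (nth [::] Gamma p.+1) t].

Definition two_loop (gamma0 : seq (vertex T)) (Gamma : seq (seq (vertex T))) : Prop :=
  [/\ two_path Gamma, head [::] Gamma = gamma0 & last [::] Gamma = gamma0].

Definition sweeps_once (Gamma : seq (seq (vertex T))) : Prop :=
  forall t, t \in triangles T ->
    exists! p, (p.+1 < size Gamma)%N /\ sweeps (nth [::] Gamma p) (nth [::] Gamma p.+1) t.

(* zeta^p is a section over gamma_p. *)
Lemma zeta_over (C' : numClosedFieldType) (a b : vertex T) Gamma p :
  two_loop [:: a; b] Gamma -> (p < size Gamma)%N ->
  (plength (zeta C' Gamma p)).+1 = size (nth [::] Gamma p).
Proof.
move=> [[_ _ Gedge] _ Gend]; rewrite /zeta.
elim: Gamma p Gedge Gend => [//|g0 G IH] [|p] Gedge Gend ltp; last first.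
  case: G IH Gedge Gend ltp => [//|g1 G] IH Gedge Gend ltp.
  by apply: IH => // q; apply: (Gedge q.+1).
case: G IH Gedge Gend ltp => [_ _ /= -> //|g1 G IH Gedge Gend _].
have IHg : (plength (zeta_rec C' (g1 :: G))).+1 = size g1.
  by apply: (IH 0%N) => // q; apply: (Gedge q.+1).
have [t [_ _ /= st]] := Gedge 0%N isT.
have zy x y z : [set x; y; z] \in triangles T -> z != y.
  move=> /card_triangle ht; apply/eqP=> zy; move: ht; rewrite zy => ht.
  suff : (#|[set x; y; y]| <= 2)%N by rewrite ht.
  by rewrite -finset.setUA finset.setUid cards2; case: eqP.
rewrite -[plength _]/(plength (Phi g0 g1 (zeta_rec C' (g1 :: G)))).
move: (zeta_rec C' (g1 :: G)) IHg => s IHg.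
case: st => [] [q [x [y [z [r [h0 h1 -> /zy nzy]]]]]].
  move: IHg; rewrite h0 h1 Phi_contract // !size_cat /= !addnS => -[IHg].
  by rewrite plength_contract IHg // ltnS leq_addr.
move: IHg; rewrite h0 h1 Phi_expand // !size_cat /= !addnS => -[IHg].
by rewrite plength_expand IHg // ltnS leq_addr.
Qed.
End TwoPaths.

End Triangulations.

(* Main.v *)
From Pilot Require Import Defs.
From HB Require Import structures.
From mathcomp Require Import all_boot all_order all_algebra.
From mathcomp Require Import all_classical all_reals all_analysis.
From mathcomp Require Import complex ring zify.

(** The equivalence holds for each triangulation [T] separately, and it rests on
    one scalar attached to the 2-loop.

    Composing the arrows of a section along its edge-path, downwards or upwards,
    and reading the factors [V] on the basis [e] gives a vector for each word of
    colours in ['I_3], one letter per edge of the path ([down_coef], [up_coef]).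
    A local move changes these vectors by a rule which only involves the
    coefficients [i eps_abc] of [F] and [Ft]: it merges two adjacent letters or
    splits one ([merge_letters], [split_letter], [down_coef_contract] and the
    lemmas after it).  Iterating along the 2-loop yields a linear operator [amp]
    on functions of words.

    Between the two copies of the base edge, [amp] is a 3 x 3 matrix.  The tensor
    [eps] is invariant under the rotations which permute and negate the axes, and
    so is that matrix; hence it is a scalar [mu] ([amp_scalar]).  This elementary
    substitute for Schur's lemma says that the section at index 0 is [mu] times the
    base section.

    The number [mu] is a nonzero multiple of the chromatic index
    ([amp_loop_eq0]).  To see this, sum over all colourings [u] of the edges the
    product of the triangle weights, and integrate out the edges in the order in
    which they disappear from the paths.  Each edge lies in at most two triangles,
    by coherence of the orientation, and each triangle is swept once; therefore an
    edge other than the base edge which leaves the path never comes back and lies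
    in no triangle still to be swept ([dying_edge]), and the partial sums are the
    coefficients of [amp] ([state_sum_step]).

    If the chromatic index is nonzero, so is [mu]; a zero arrow in some section
    kills all its coefficients, hence those of the section at index 0; but these are
    [mu] times the coefficients of the base section, which are not all zero.
    Conversely, if no arrow vanishes, the section at index 0 has a nonzero
    coefficient, and [mu] is nonzero. *)

Set Implicit Arguments.
Unset Strict Implicit.
Unset Printing Implicit Defensive.

Import Order.TTheory GRing.Theory Num.Theory.

Local Open Scope ring_scope.

(** * Transfer of functions of colour words along a 2-path *)

Lemma backward_ind (N : nat) (P : nat -> Prop) : P N.-1 ->
  (forall p, (p.+1 < N)%N -> P p.+1 -> P p) -> forall p, (p < N)%N -> P p.
Proof.
move=> P_last P_step p hp; rewrite -(subKn (n := N.-1) (m := p)); last by case: (N) hp.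
elim: (N.-1 - p)%N => [|k IH]; first by rewrite subn0.
have [le|lt] := leqP N.-1 k.
  by move: IH; rewrite (eqP le) (eqP (leqW le)).
by apply: P_step; rewrite subnSK //; case: (N) lt hp => // M _ _; rewrite ltnS leq_subr.
Qed.

Section Transfer.
Variables (C : numClosedFieldType) (s : C).
Implicit Types (w v : seq 'I_3).

Section Values.
Variable W : lmodType C.
Implicit Types (A : seq 'I_3 -> W).

(** The scalar [s] is 1 for the arrows going down the path and -1 for those going
    up: the two kinds of arrows exchange the roles of [F] and [Ft], whose
    coefficients on the basis are opposite. *)
Definition merge_letters A w : W :=
  if w is a :: w' then \sum_b \sum_c (s * ('i * eps C b c a)) *: A [:: b, c & w']
  else 0.

Definition split_letter A w : W :=
  if w is [:: b, c & w'] then \sum_a (- (s * ('i * eps C b c a))) *: A (a :: w')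
  else 0.

Fixpoint at_pos (f : (seq 'I_3 -> W) -> seq 'I_3 -> W) (j : nat) A w : W :=
  match j, w with
  | 0, _ => f A w
  | j'.+1, a :: w' => at_pos f j' (fun v => A (a :: v)) w'
  | _.+1, [::] => 0
  end.

Lemma at_pos_cat f w v A : at_pos f (size w) A (w ++ v) = f (fun v' => A (w ++ v')) v.
Proof. by elim: w A => [|a w IH] A //=; rewrite IH. Qed.

(** The effect on coefficients of the local move from sections over [beta] to
    sections over [alpha]. *)
Definition transfer (X : eqType) (alpha beta : seq X) :=
  at_pos (if (size alpha < size beta)%N then merge_letters else split_letter)
    (common_prefix alpha beta).-1.

Fixpoint amp_rec (X : eqType) A (Gamma : seq (seq X)) : seq 'I_3 -> W :=
  if Gamma is alpha :: Gamma' then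
    if Gamma' is beta :: _ then transfer alpha beta (amp_rec A Gamma') else A
  else A.

Definition amp (X : eqType) A (Gamma : seq (seq X)) (p : nat) :=
  amp_rec A (drop p Gamma).

Lemma amp_step (X : eqType) A (Gamma : seq (seq X)) p : (p.+1 < size Gamma)%N ->
  amp A Gamma p = transfer (nth [::] Gamma p) (nth [::] Gamma p.+1) (amp A Gamma p.+1).
Proof.
move=> h; rewrite /amp (drop_nth [::] (ltnW h)) /=.
by rewrite (drop_nth [::] h).
Qed.

Lemma amp_last (X : eqType) A (Gamma : seq (seq X)) : amp A Gamma (size Gamma).-1 = A.
Proof.
rewrite /amp; case: Gamma => [//|g G].
by rewrite (drop_nth [::]) //= drop_size.
Qed.

(** The transfer is linear, so a section all of whose coefficients vanish is
    followed only by such sections. *)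
Lemma amp0 (X : eqType) A (Gamma : seq (seq X)) p : (p < size Gamma)%N ->
  (forall w, amp A Gamma p w = 0) -> forall w, amp A Gamma 0 w = 0.
Proof.
elim: p => [//|p IH] hp h; apply: IH; first exact: ltnW.
move=> w; rewrite amp_step // /transfer.
move: (_.-1) (amp A Gamma p.+1) h => j B; elim: j w B => [|j IHj] [|a w] B h //=.
- by case: ifP.
- case: ifP => _ /=.
    by rewrite big1 // => b _; rewrite big1 // => c _; rewrite h scaler0.
  by case: w => // c w; rewrite big1 // => d _; rewrite h scaler0.
- by apply: IHj => v; apply: h.
Qed.

(** The linear map sending the basis vector of index [a] to [tau a] times that of
    index [pi a] is a rotation permuting the coordinate axes. *)
Section Rotation.
Variables (pi : 'I_3 -> 'I_3) (tau : 'I_3 -> C).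
Hypothesis pi_bij : bijective pi.
Hypothesis tau_sqr : forall a, tau a * tau a = 1.
Hypothesis eps_rot : forall a b c,
  eps C (pi a) (pi b) (pi c) * (tau a * tau b * tau c) = eps C a b c.

(** The extra scalar [eta] is what makes induction on the position possible:
    freezing the first letter [a] of the words multiplies [eta] by [tau a]. *)
Definition rotates eta A A' :=
  forall w, (\prod_(a <- w) tau a) *: A' (map pi w) = eta *: A w.

Lemma merge_letters_rotation eta A A' :
  rotates eta A A' -> rotates eta (merge_letters A) (merge_letters A').
Proof.
move=> h [|a w] /=; first by rewrite !scaler0.
rewrite !scaler_sumr (reindex _ (onW_bij _ pi_bij)); apply: eq_bigr => b _.
rewrite !scaler_sumr (reindex _ (onW_bij _ pi_bij)); apply: eq_bigr => c _.
have := h [:: b, c & w]; rewrite /= !big_cons => H.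
rewrite scalerA [in RHS]scalerA [eta * _]mulrC -[in RHS]scalerA -H scalerA.
rewrite -(eps_rot b c a).
congr (_ *: _); have b2 := tau_sqr b; have c2 := tau_sqr c; ring: b2 c2.
Qed.

Lemma split_letter_rotation eta A A' :
  rotates eta A A' -> rotates eta (split_letter A) (split_letter A').
Proof.
move=> h [|b [|c w]] /=; rewrite ?scaler0 //.
rewrite !scaler_sumr (reindex _ (onW_bij _ pi_bij)); apply: eq_bigr => a _.
have := h (a :: w); rewrite /= !big_cons => H.
rewrite scalerA [in RHS]scalerA [eta * _]mulrC -[in RHS]scalerA -H scalerA.
rewrite -(eps_rot b c a).
congr (_ *: _); have a2 := tau_sqr a; ring: a2.
Qed.

Lemma at_pos_rotation f j :
  (forall eta A A', rotates eta A A' -> rotates eta (f A) (f A')) ->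
  forall eta A A', rotates eta A A' -> rotates eta (at_pos f j A) (at_pos f j A').
Proof.
move=> hf; elim: j => [|j IH] eta A A' h; first exact: hf.
case=> [|a w] /=; first by rewrite !scaler0.
rewrite big_cons -scalerA (IH (tau a * eta) (fun v => A (a :: v))).
  by rewrite scalerA mulrA tau_sqr mul1r.
move=> v; have := h (a :: v); rewrite big_cons /= -scalerA => H.
by rewrite -scalerA -H !scalerA mulrA tau_sqr mul1r.
Qed.

Lemma amp_rotation (X : eqType) (Gamma : seq (seq X)) p eta A A' :
  rotates eta A A' -> rotates eta (amp A Gamma p) (amp A' Gamma p).
Proof.
move=> h; rewrite /amp; elim: (drop p Gamma) => [|al [|be G] IH] //.
apply: at_pos_rotation => // ? ? ?.
by case: ifP => _; [apply: merge_letters_rotation|apply: split_letter_rotation].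
Qed.

End Rotation.

End Values.

Lemma at_pos_map (W W' : lmodType C) (g : {linear W -> W'}) (b : bool) j
    (A : seq 'I_3 -> W) w :
  at_pos (if b then @merge_letters W' else @split_letter W') j (fun v => g (A v)) w =
  g (at_pos (if b then @merge_letters W else @split_letter W) j A w).
Proof.
elim: j A w => [|j IH] A [|a w] //=; rewrite ?linear0 //.
  by case: b; rewrite /= linear0.
case: b => /=.
  rewrite linear_sum; apply: eq_bigr => b _; rewrite linear_sum.
  by apply: eq_bigr => c _; rewrite linearZ.
case: w => [|c w]; first by rewrite linear0.
by rewrite linear_sum; apply: eq_bigr => d _; rewrite linearZ.
Qed.

(** Vector-valued functions of words reduce to scalar ones: a decomposition of the
    values on fixed vectors [B i] is transported by the transfer. *)
Section Expansion.
Variables (W : lmodType C) (I : finType) (B : I -> W).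

Definition expands (A : seq 'I_3 -> W) (D : I -> seq 'I_3 -> C^o) :=
  forall w, A w = \sum_i D i w *: B i.

Lemma merge_letters_expands A D :
  expands A D -> expands (merge_letters A) (fun i => merge_letters (D i)).
Proof.
move=> h [|a w] /=; first by rewrite big1 // => i _; rewrite scale0r.
under [RHS]eq_bigr do rewrite scaler_suml.
rewrite [RHS]exchange_big; apply: eq_bigr => b _.
under [RHS]eq_bigr do rewrite scaler_suml.
rewrite [RHS]exchange_big; apply: eq_bigr => c _.
by rewrite h scaler_sumr; apply: eq_bigr => i _; rewrite scalerA.
Qed.

Lemma split_letter_expands A D :
  expands A D -> expands (split_letter A) (fun i => split_letter (D i)).
Proof.
move=> h [|b [|c w]] /=; do ?by rewrite big1 // => i _; rewrite scale0r.
under [RHS]eq_bigr do rewrite scaler_suml.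
rewrite [RHS]exchange_big; apply: eq_bigr => a _.
by rewrite h scaler_sumr; apply: eq_bigr => i _; rewrite scalerA.
Qed.

Lemma at_pos_expands (b : bool) j A D : expands A D ->
  expands (at_pos (if b then @merge_letters W else @split_letter W) j A)
    (fun i => at_pos (if b then @merge_letters C^o else @split_letter C^o) j (D i)).
Proof.
elim: j A D => [|j IHj] A D h /=.
  by case: b; [apply: merge_letters_expands|apply: split_letter_expands].
case=> [|a w]; first by rewrite big1 // => i _; rewrite scale0r.
by apply: (IHj _ (fun i v => D i (a :: v))) => v; apply: h.
Qed.

Lemma amp_expands (X : eqType) (Gamma : seq (seq X)) p A D : expands A D ->
  expands (amp A Gamma p) (fun i => amp (D i) Gamma p).
Proof.
move=> h; rewrite /amp; elim: (drop p Gamma) => [|al [|be G] IH] //.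
exact: at_pos_expands.
Qed.

End Expansion.

Definition delta c : seq 'I_3 -> C^o := fun w => (w == [:: c])%:R.

Lemma expands_delta (W : lmodType C) (A : seq 'I_3 -> W) :
  (forall w, size w != 1%N -> A w = 0) -> expands (fun c => A [:: c]) A delta.
Proof.
move=> A1 w; have [|h] := boolP (size w == 1%N); last first.
  rewrite A1 // big1 // => c _; rewrite /delta; case: eqP => [wE|_].
    by rewrite wE in h.
  by rewrite scale0r.
case: w => [//|d [|//]] _; rewrite (bigD1 d) //= /delta eqxx scale1r.
rewrite big1 ?addr0 // => c cd; rewrite eqseq_cons andbT eq_sym (negPf cd).
by rewrite scale0r.
Qed.

Lemma eps_shift a b c : eps C (a + 1) (b + 1) (c + 1) = eps C a b c.
Proof. by rewrite /eps !(addrAC a 1) !(inj_eq (addIr _)). Qed.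

Section Loop.
Variables (X : eqType) (Gamma : seq (seq X)).
Local Notation loop_coef c := (amp (delta c) Gamma 0).

(** The cyclic shift of the three axes is a rotation. *)
Lemma amp_diag c : loop_coef c [:: c] = loop_coef 0 [:: 0].
Proof.
have shift d : loop_coef (d + 1) [:: d + 1] = loop_coef d [:: d].
  have := @amp_rotation C^o (+%R^~ 1) (fun=> 1) _ _ _ X Gamma 0 1 (delta d) (delta (d + 1)).
  move=> /(_ _ _ _ _ [:: d]); rewrite big_seq1 !scale1r; apply.
  - by exists (+%R^~ (-1)); [apply: addrK|apply: subrK].
  - by move=> _; rewrite mulr1.
  - by move=> a b e; rewrite !mulr1 eps_shift.
  move=> w; rewrite big1 // !scale1r /delta -[[:: d + 1]]/(map (+%R^~ 1) [:: d]).
  by rewrite (inj_eq (inj_map (addIr _))).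
have A1 := shift 0; have A2 := shift 1; rewrite add0r in A1; rewrite add3E in A2.
by move: c; apply: ord3; [apply: erefl|rewrite A1|rewrite A2 A1].
Qed.

(** The half-turn around the axis [c] fixes the base vector of index [c] and negates
    the one of index [d]. *)
Lemma amp_offdiag c d : c != d -> loop_coef c [:: d] = 0.
Proof.
move=> cd; pose tau a : C := if a == c then 1 else -1.
have := @amp_rotation C^o id tau _ _ _ X Gamma 0 1 (delta c) (delta c).
move=> /(_ _ _ _ _ [:: d]); rewrite big_seq1 /tau eq_sym (negPf cd) scale1r scaleN1r /=.
rewrite -/tau => h.
have {}h : - loop_coef c [:: d] = loop_coef c [:: d].
  apply: h => [|a|a b e|w].
  - by exists id.
  - by rewrite /tau; case: ifP; rewrite ?mulr1 // mulrNN mulr1.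
  - rewrite /eps /tau; case: ifP => [/andP[/eqP-> /eqP->]|_].
      by move: a; apply: ord3; move: (c); apply: ord3; rewrite /=; ring.
    case: ifP => [/andP[/eqP-> /eqP->]|_]; last by rewrite mul0r.
    by move: a; apply: ord3; move: (c); apply: ord3; rewrite /=; ring.
  rewrite scale1r map_id /delta; case: eqP => [->|_]; last by rewrite scaler0.
  by rewrite big_seq1 /tau eqxx scale1r.
by apply/eqP; rewrite -eqNr h.
Qed.

Lemma amp_scalar (W : lmodType C) (A : seq 'I_3 -> W) d :
  (forall w, size w != 1%N -> A w = 0) ->
  amp A Gamma 0 [:: d] = loop_coef 0 [:: 0] *: A [:: d].
Proof.
move=> A1; rewrite (amp_expands Gamma 0 (expands_delta A1)) (bigD1 d) //= big1 ?addr0.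
  by rewrite amp_diag.
by move=> c cd; rewrite amp_offdiag // scale0r.
Qed.

End Loop.
End Transfer.

(** * Coefficients of a section *)

Section Evaluation.
Variable C : numClosedFieldType.
Local Notation module := (module C).
Implicit Types (M N E : module) (w : seq 'I_3).

(** The module at the end of a path is hidden in the type of the section.  Local
    moves keep it, and comparing it with a fixed module [E], with value 0 if
    they differ, avoids transporting along equalities of modules. *)
Definition coerce M N (m : M) : N :=
  if pselect (M = N) is left h then eq_rect M (fun P : module => P) m N h else 0.

Lemma coerce_id M (m : M) : coerce M m = m.
Proof.
rewrite /coerce; case: pselect => [h|//].
by rewrite (Prop_irrelevance h erefl).
Qed.

Lemma coerce_linear M N : linear (@coerce M N).
Proof.
rewrite /coerce; case: pselect => [h|_] k x y; last by rewrite scaler0 addr0.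
by case: N / h.
Qed.

(** [down_coef E s w] is the component of index [w] of the composite map from the
    first module of [s] to V ... V E, and [up_coef E s w] is the restriction of
    the composite in the other direction to the summand of index [w].  Both are 0
    when the length of [w] differs from that of the path. *)
Fixpoint down_coef E M (s : psection M) : seq 'I_3 -> M -> E :=
  match s in psection M return seq 'I_3 -> M -> E with
  | Stop M => fun w m => if w is [::] then coerce E m else 0
  | @Step _ M N dn up s' => fun w m =>
      if w is a :: w' then down_coef E s' w' (dn m a) else 0
  end.

Fixpoint up_coef E M (s : psection M) : seq 'I_3 -> E -> M :=
  match s in psection M return seq 'I_3 -> E -> M with
  | Stop M => fun w x => if w is [::] then coerce M x else 0
  | @Step _ M N dn up' s' => fun w x =>
      if w is a :: w' then up' (tens (e C a) (up_coef s' w' x)) else 0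
  end.

Arguments up_coef E {M} s w x.

Lemma down_coef_linear E M (s : psection M) w : linear (down_coef E s w).
Proof.
elim: s w => [{}M|{}M N dn up' s IH] [|a w] k x y /=; rewrite ?scaler0 ?addr0 //.
  exact: coerce_linear.
by rewrite linearP /= !ffunE IH.
Qed.

HB.instance Definition _ E M (s : psection M) w :=
  GRing.isLinear.Build C M E _ (down_coef E s w) (down_coef_linear E s w).

Lemma FtI_coord M (x : tensor (tensor M)) a :
  FtI M x a = \sum_b \sum_c ('i * eps C b c a) *: x b c.
Proof.
rewrite lfunE /= /FtI_fun sum_ffunE; apply: eq_bigr => b _.
rewrite sum_ffunE; apply: eq_bigr => c _.
rewrite ffunE; congr (_ *: _); rewrite FtE brE !eE /eps.
by move: a; apply: ord3; move: b; apply: ord3; move: c; apply: ord3;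
  rewrite ?add0r ?add3E /=; ring.
Qed.

Lemma F_e a b c : F C (e C a) b 0 c = - ('i * eps C b c a).
Proof.
rewrite lfunE /= F_coord (bigD1 a) //= big1 ?addr0; first by rewrite eE eqxx mul1r.
by move=> d da; rewrite eE (negPf da) mul0r.
Qed.

Lemma FI_coord M (x : tensor M) b c :
  FI M x b c = \sum_a (- ('i * eps C b c a)) *: x a.
Proof.
rewrite lfunE /= /FI_fun sum_ffunE sum_ffunE; apply: eq_bigr => a _.
by rewrite !ffunE F_e.
Qed.

Lemma idt_coord M N (f : Defs.hom M N) (x : tensor M) a : idt f x a = f (x a).
Proof. by rewrite lfunE /= ffunE. Qed.

Lemma down_coef_contract E j M (s : psection M) w m : (j.+1 < plength s)%N ->
  down_coef E (modify_at (@Defs.contract C) j s) w m =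
    at_pos (@merge_letters C 1 E) j (fun v => down_coef E s v m) w.
Proof.
elim: s j w m => [//|{}M N dn up' s IH] [|j] [|a w] m //=.
- by case: s dn up' {IH} => [//|? ? ? ? ?].
- case: s dn up' {IH} => [//|{}N P dn' up'' s] dn up' _ /=.
  rewrite comp_lfunE FtI_coord linear_sum; apply: eq_bigr => b _.
  rewrite linear_sum; apply: eq_bigr => c _.
  rewrite linearZ /= mul1r comp_lfunE; congr (_ *: down_coef E s w _).
  exact: (congr1 (fun x : tensor P => x c) (idt_coord dn' (dn m) b)).
- by move=> h; rewrite IH.
Qed.

Lemma down_coef_expand E j M (s : psection M) w m : (j < plength s)%N ->
  down_coef E (modify_at (@Defs.expand C) j s) w m =
    at_pos (@split_letter C 1 E) j (fun v => down_coef E s v m) w.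
Proof.
elim: s j w m => [//|{}M N dn up' s IH] [|j] [|a w] m //=; last first.
  by move=> h; rewrite IH.
move=> _; case: w => [//|b w]; rewrite id_lfunE comp_lfunE FI_coord linear_sum.
by apply: eq_bigr => c _; rewrite linearZ /= mul1r.
Qed.

Lemma tens0r M v : tens v (0 : M) = 0.
Proof. by apply/ffunP => a; rewrite !ffunE scaler0. Qed.

Lemma FI_tens_e M a (m : M) : FI M (tens (e C a) m) =
  \sum_b \sum_c (- ('i * eps C b c a)) *:
    (tens (e C b) (tens (e C c) m : tensor M) : tensor (tensor M)).
Proof.
rewrite FI_tens -[RHS]/(\sum_b _) [F C _]tens_sum tens2_suml; apply: eq_bigr => b _.
rewrite tens2_tens [F C _ b]e_sum tens_suml.
rewrite (big_morph _ (tensDr (e C b)) (tens0r (tensor M) (e C b))).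
by apply: eq_bigr => c _; rewrite tensZl tensZr F_e.
Qed.

Lemma FtI_tens_e M b c (m : M) : FtI M (tens (e C b) (tens (e C c) m : tensor M)) =
  \sum_a ('i * eps C b c a) *: tens (e C a) m.
Proof.
rewrite FtI_tens [br _ _]e_sum tens_suml; apply: eq_bigr => a _.
rewrite tensZl; congr (_ *: _); rewrite brE !eE /eps.
by move: a; apply: ord3; move: b; apply: ord3; move: c; apply: ord3;
  rewrite ?add0r ?add3E /=; ring.
Qed.

Definition up_step M N (up' : Defs.hom (tensor N) M) a (m : N) : M :=
  up' (tens (e C a) m).

Lemma up_step_linear M N (up' : Defs.hom (tensor N) M) a : linear (up_step up' a).
Proof. by move=> k x y; rewrite /up_step tens_linearr linearP. Qed.

HB.instance Definition _ M N (up' : Defs.hom (tensor N) M) a :=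
  GRing.isLinear.Build C N M _ (up_step up' a) (up_step_linear up' a).

Lemma up_coef_contract E j M (s : psection M) w x : (j.+1 < plength s)%N ->
  up_coef E (modify_at (@Defs.contract C) j s) w x =
    at_pos (@merge_letters C (-1) M) j (fun v => up_coef E s v x) w.
Proof.
elim: s j w => [//|{}M N dn up' s IH] [|j] [|a w] //=.
- by case: s dn up' {IH} => [//|? ? ? ? ?].
- case: s dn up' {IH} => [//|{}N P dn' up'' s] dn up' _ /=.
  rewrite !comp_lfunE FI_tens_e.
  rewrite !linear_sum; apply: eq_bigr => b _.
  rewrite !linear_sum; apply: eq_bigr => c _.
  rewrite !linearZ /= mulN1r; congr (_ *: _).
  exact: (congr1 (fun z : tensor N => up' z)
    (@idtE C (tensor P) N up'' (e C b) (tens (e C c) (up_coef E s w x)))).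
- by move=> h; rewrite IH // (at_pos_map _ (up_step up' a) true).
Qed.

Lemma up_coef_expand E j M (s : psection M) w x : (j < plength s)%N ->
  up_coef E (modify_at (@Defs.expand C) j s) w x =
    at_pos (@split_letter C (-1) M) j (fun v => up_coef E s v x) w.
Proof.
elim: s j w => [//|{}M N dn up' s IH] [|j] [|a w] //=; last first.
  by move=> h; rewrite IH // (at_pos_map _ (up_step up' a) false).
move=> _; case: w => [|b w]; first by rewrite tens0r linear0.
rewrite id_lfunE comp_lfunE FtI_tens_e linear_sum.
by apply: eq_bigr => c _; rewrite linearZ /= mulN1r opprK.
Qed.

(** A zero arrow kills the composite maps in its direction. *)
Lemma nonvanishing_coef E M (sec : psection M) w m w' x :
  down_coef E sec w m != 0 -> up_coef E sec w' x != 0 -> nonvanishing sec.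
Proof.
elim: sec w m w' => [//|{}M N dn up' sec IH] [|c w] m [|c' w'] /=; rewrite ?eqxx //.
move=> hdn hup; split; last split.
- by apply: contra_neq_not hdn => ->; rewrite lfunE /= ffunE linear0.
- by apply: contra_neq_not hup => ->; rewrite lfunE.
apply: (IH w _ w' hdn); apply: contra_neq hup => ->.
by rewrite tens0r linear0.
Qed.

Lemma down_coef_base E w m : size w != 1%N -> down_coef E (base_section C) w m = 0.
Proof. by case: w => [//|c [//|d w]]. Qed.

Lemma up_coef_base E w x : size w != 1%N -> up_coef E (base_section C) w x = 0.
Proof. by case: w => [//|c [//|d w]] /= _; rewrite tens0r linear0. Qed.

(** The coefficient of index (1, 2) of F(e_0) is -i. *)
Lemma down_coef_base_neq0 : down_coef (adj C) (base_section C) [:: 1] (e C 0) != 0.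
Proof.
rewrite /= coerce_id; apply/eqP=> /rowP/(_ 2%:R).
rewrite F_e mxE => /eqP; rewrite /eps !add3E /=.
by rewrite oppr_eq0 mulf_eq0 (negPf (neq0Ci C)) /= oner_eq0.
Qed.

(** [Ft] is the bracket, and [e_0, e_1] = i e_2. *)
Lemma up_coef_base_neq0 : up_coef (adj C) (base_section C) [:: 0] (e C 1) != 0.
Proof.
rewrite /= coerce_id FtE; apply/eqP=> /rowP/(_ 2%:R).
rewrite brE !eE mxE => /eqP; rewrite !add3E /=.
by rewrite mulf_eq0 (negPf (neq0Ci C)) mulr1 mul0r subr0 oner_eq0.
Qed.

(** For [E] the end module of the section, [coerce] is the identity and the
    coefficients are the coordinates of the arrow itself. *)
Lemma single_edge_coef M (sec : psection M) : nonvanishing sec ->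
  plength sec = 1%N -> exists E d m, down_coef E sec [:: d] m != 0.
Proof.
case: sec => [//|{}M N dn up' sec].
case: sec dn up' => [{}N|//] dn up' /= [dn0 _] _; apply: contra_notP dn0 => none.
apply/lfunP=> m; apply/ffunP=> d; rewrite lfunE /= ffunE.
apply/eqP; apply: contra_notT none => dn0.
by exists N, d, m; rewrite /= coerce_id.
Qed.

End Evaluation.
Arguments up_coef {C} E {M} s w x.

(** * Edge colourings and triangle weights *)

Lemma det_e (C : numClosedFieldType) (a b c : 'I_3) :
  \det (\matrix_(k < 3) tnth [tuple e C a; e C b; e C c] k) = eps C a b c.
Proof.
rewrite (expand_det_row _ ord0) !big_ord_recl big_ord0 /cofactor !(expand_det_row _ ord0).
rewrite !big_ord_recl !big_ord0 /cofactor !det_mx11 !mxE /eps.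
by move: a; apply: ord3; move: b; apply: ord3; move: c; apply: ord3;
  rewrite -!val_eqE /=; ring.
Qed.

Lemma eps_cyclic (C : numClosedFieldType) (a b c : 'I_3) : eps C b c a = eps C a b c.
Proof.
by move: a; apply: ord3; move: b; apply: ord3; move: c; apply: ord3;
  rewrite /eps -!val_eqE.
Qed.

Lemma eps_swap (C : numClosedFieldType) (a b c : 'I_3) : eps C a c b = - eps C a b c.
Proof.
by move: a; apply: ord3; move: b; apply: ord3; move: c; apply: ord3;
  rewrite /eps -!val_eqE /= ?opprK ?oppr0.
Qed.

Section Weights.
Variables (R : realType) (T : triangulation R).
Local Notation C := R[i].
Local Notation V := (vertex T).
Local Notation colouring := {ffun edge T -> 'I_3}.
Implicit Types (u : colouring) (s t : {set V}).

Definition colour u s : 'I_3 := oapp u 0 (insub s).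

Definition recolour u s (a : 'I_3) : colouring :=
  [ffun f => if val f == s then a else u f].

Lemma colour_recolour u s a s' : s \in edges T ->
  colour (recolour u s a) s' = if s' == s then a else colour u s'.
Proof.
move=> hs; rewrite /colour; case: insubP => [f hf fE|]; first by rewrite /= ffunE fE.
by case: eqP => // ->; rewrite hs.
Qed.

(** Integrating out the edge [s] before summing over all colourings only counts
    each colouring three times. *)
Lemma sum_recolour s (g : colouring -> C) : s \in edges T ->
  \sum_u \sum_a g (recolour u s a) = 3%:R * \sum_u g u.
Proof.
move=> hs.
(* shifting the colour of s by a fixed amount is a bijection of the colourings *)
transitivity (\sum_u \sum_a g (recolour u s (colour u s + a))).
  by apply: eq_bigr => u _; rewrite (reindex_inj (addrI (colour u s))).
rewrite exchange_big (eq_bigr (fun=> \sum_u g u)) => [|a _].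
  by rewrite sumr_const card_ord mulr_natl.
have recolourK b : cancel (fun u => recolour u s (colour u s + b))
    (fun u => recolour u s (colour u s - b)).
  move=> u; apply/ffunP=> f; rewrite ffunE colour_recolour // eqxx addrK.
  case: eqP => [<-|nf]; last by rewrite ffunE; case: eqP.
  by rewrite /colour valK.
rewrite [RHS](reindex (fun u => recolour u s (colour u s + a))) //.
apply: onW_bij; exists (fun u => recolour u s (colour u s - a)) => // u.
by have := recolourK (- a) u; rewrite opprK.
Qed.

Definition weight t u : C :=
  if [pick p : V * V * V |
        positive p.1.1 p.1.2 p.2 && ([set p.1.1; p.1.2; p.2] == t)] is Some p
  then triangle_factor u p.1.1 p.1.2 p.2 else 1.

Lemma chromatic_indexE :
  chromatic_index T = \sum_u \prod_(t in triangles T) weight t u.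
Proof. by []. Qed.

Lemma triangleE x y z : [set x; y; z] \in triangles T ->
  [/\ x != y, y != z & x != z].
Proof.
move=> /card_triangle; rewrite -!finset.setUA cardsU1 cards2 !inE negb_or.
by case: (x == y); case: (x == z); case: (y == z).
Qed.

(** The three even orderings come first, then the three odd ones. *)
Lemma set3_perm (x y z a b c : V) : x != y -> y != z -> x != z ->
  [set a; b; c] = [set x; y; z] ->
  (a, b, c) \in [:: (x, y, z); (y, z, x); (z, x, y); (x, z, y); (z, y, x); (y, x, z)].
Proof.
move=> xy yz xz h.
have abc : [/\ a \in [set x; y; z], b \in [set x; y; z] & c \in [set x; y; z]].
  by rewrite -h !inE !eqxx ?orbT.
have xyz : [/\ x \in [set a; b; c], y \in [set a; b; c] & z \in [set a; b; c]].
  by rewrite h !inE !eqxx ?orbT.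
have neqs : ((x == y) = false) * ((y == x) = false) * ((y == z) = false) *
    ((z == y) = false) * ((x == z) = false) * ((z == x) = false).
  by rewrite !(eq_sym y x) !(eq_sym z) (negPf xy) (negPf yz) (negPf xz).
case: abc => ha hb hc; case: xyz => hx hy hz; move: ha hb hc hx hy hz {h}.
rewrite !inE !xpair_eqE.
by do 3 (case/orP=> [/orP[]|] /eqP->); rewrite ?eqxx ?neqs.
Qed.

Lemma sub_triangle (x y z : V) : [/\ [set x; y] \subset [set x; y; z],
  [set y; z] \subset [set x; y; z] & [set x; z] \subset [set x; y; z]].
Proof.
by split; apply/fintype.subsetP=> v; rewrite !inE => /orP[] ->; rewrite ?orbT.
Qed.

Lemma triangle_edges_neq x y z : [set x; y; z] \in triangles T ->
  [/\ [set x; y] != [set y; z], [set x; y] != [set x; z] & [set y; z] != [set x; z]].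
Proof.
move=> /triangleE[xy yz xz].
split; apply/eqP=> /setP.
- by move/(_ x); rewrite !inE eqxx (negPf xy) (negPf xz).
- by move/(_ y); rewrite !inE eqxx orbT eq_sym (negPf xy) (negPf yz).
- by move/(_ x); rewrite !inE eqxx (negPf xy) (negPf xz).
Qed.

Lemma triangle_edges x y z : [set x; y; z] \in triangles T ->
  [/\ [set x; y] \in edges T, [set y; z] \in edges T & [set x; z] \in edges T].
Proof.
move=> ht; have [xy yz xz] := triangleE ht.
by have [xyT yzT xzT] := sub_triangle x y z; split;
  apply: (face_closed ht); rewrite ?cards2 ?xy ?yz ?xz.
Qed.

Lemma edge_vecE u x y :
  [set x; y] \in edges T -> edge_vec u x y = e C (colour u [set x; y]).
Proof. by rewrite /edge_vec /colour => h; rewrite insubT. Qed.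

Lemma triangle_factorE u x y z : [set x; y; z] \in triangles T ->
  triangle_factor u x y z =
    'i * eps C (colour u [set x; y]) (colour u [set y; z]) (colour u [set x; z]).
Proof.
move=> /triangle_edges[h1 h2 h3].
by rewrite /triangle_factor (finset.setUC [set x] [set z]) !edge_vecE // ?det_e //
  1?finset.setUC.
Qed.

(** The factor [k] is a sign, which records whether the ordering of the vertices is
    positive; it does not depend on the colouring, so it is harmless. *)
Lemma weightE x y z : [set x; y; z] \in triangles T -> exists2 k : C, k != 0 &
  forall u, 'i * eps C (colour u [set x; y]) (colour u [set y; z]) (colour u [set x; z])
    = k * weight [set x; y; z] u.
Proof.
move=> ht; rewrite /weight; case: pickP => [[[a b] c] /= /andP[pos /eqP h]|]; last first.
  move=> none; have := positive_alt ht; have := none (x, y, z).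
  have := none (x, z, y).
  rewrite /= -!(finset.setUA [set x]) (finset.setUC [set z]) !eqxx !andbT.
  by move=> -> ->.
have [xy yz xz] := triangleE ht.
have ht' : [set a; b; c] \in triangles T by rewrite h.
have signs (P : C -> Prop) : P 1 \/ P (-1) -> exists2 k : C, k != 0 & P k.
  by case=> Pk; [exists 1; rewrite ?oner_neq0|exists (-1); rewrite ?oppr_eq0 ?oner_neq0].
apply: signs; have {h pos} := set3_perm xy yz xz h; rewrite !inE.
have s (p q : V) := finset.setUC [set p] [set q].
do 5?case/orP; move=> /eqP[aE bE cE]; subst a b c.
- by left=> u; rewrite triangle_factorE // mul1r.
- by left=> u; rewrite triangle_factorE // mul1r (s z x) (s y x) [in RHS]eps_cyclic.
- left=> u; rewrite triangle_factorE // mul1r (s z x) (s z y).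
  by rewrite [in RHS]eps_cyclic [in RHS]eps_cyclic.
- right=> u; rewrite triangle_factorE // (s z y) [in RHS]eps_swap [in RHS]eps_cyclic.
  by rewrite [in RHS]eps_cyclic; ring.
- right=> u; rewrite triangle_factorE // (s z y) (s y x) (s z x).
  by rewrite [in RHS]eps_swap [in RHS]eps_cyclic; ring.
- right=> u; rewrite triangle_factorE // (s y x) [in RHS]eps_swap; ring.
Qed.

Lemma weight_recolour t u s a :
  t \in triangles T -> s \in edges T -> ~~ (s \subset t) ->
  weight t (recolour u s a) = weight t u.
Proof.
move=> ht hs st; have /card_triangle tE := ht.
have [x [y [z tE']]] : exists x y z, t = [set x; y; z].
  case: cards_eqP tE => [[|x [|y [|z []]]]//= _] _.
  by exists x, y, z; apply/setP=> v; rewrite !inE orbA.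
subst t; have [k k0 kE] := weightE ht; apply: (mulfI k0).
have neq s' : s' \subset [set x; y; z] -> (s' == s) = false.
  by move=> h; apply: contraNF st => /eqP<-.
have [xyT yzT xzT] := sub_triangle x y z.
by rewrite -!kE !colour_recolour // !neq.
Qed.

(** Two triangles on the same side of an edge coincide, by coherence of the
    orientation. *)
Lemma card_edge_triangles s : s \in edges T ->
  (#|[set t in triangles T | s \subset t]| <= 2)%N.
Proof.
move=> /card_edge/eqP/cards2P[x [y [xy ->]]].
rewrite -card_bool -(@card_in_imset _ _
  (fun t => [exists z, positive x y z && (t == [set x; y; z])])).
  exact: max_card.
have apex t : t \in [set t in triangles T | [set x; y] \subset t] ->
    exists2 z, t = [set x; y; z] & [set x; y; z] \in triangles T.
  rewrite inE => /andP[ht sub].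
  have : #|t :\: [set x; y]| == 1%N.
    by rewrite cardsD (finset.setIidPr sub) (card_triangle ht) cards2 xy.
  move=> /cards1P[z zE]; exists z; rewrite -zE.
    by rewrite -{1}(finset.setID t [set x; y]) (finset.setIidPr sub).
  by rewrite -{1}(finset.setIidPr sub) finset.setID.
move=> t t' /apex[z -> h] /apex[z' -> h'].
have right_side w : [set x; y; w] \in triangles T ->
    [exists v, positive x y v && ([set x; y; w] == [set x; y; v])] = positive x y w.
  move=> /triangleE[_ yw xw]; apply/existsP/idP=> [[v /andP[pos /eqP/setP/(_ w)]]|pos].
    by rewrite !inE eqxx orbT eq_sym (negPf xw) eq_sym (negPf yw) => /esym/eqP->.
  by exists w; rewrite pos eqxx.
rewrite !right_side //; case: (boolP (positive x y z)) => [pos /esym|neg /esym/negbT].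
  by move=> pos'; rewrite (positive_coherent pos pos').
have reverse w : [set x; y; w] \in triangles T -> ~~ positive x y w -> positive y x w.
  by move=> /positive_alt->; rewrite negbK => /positive_cyclic/positive_cyclic.
move=> /(reverse _ h')/positive_coherent/(_ (reverse _ h neg)) Ez.
by rewrite Ez.
Qed.

Lemma map_colour_recolour u s a L : s \in edges T -> s \notin L ->
  map (colour (recolour u s a)) L = map (colour u) L.
Proof.
move=> hs sL; apply/eq_in_map => s' s'L; rewrite colour_recolour //.
by case: eqP => // s'E; rewrite -s'E s'L in sL.
Qed.

End Weights.

(** * Life and death of edges along the 2-loop *)

Section Sweeping.
Variables (R : realType) (T : triangulation R).
Local Notation C := R[i].
Local Notation V := (vertex T).
Local Notation colouring := {ffun edge T -> 'I_3}.
Implicit Types (g : seq V) (f t : {set V}) (u : colouring).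

Definition path_edges g : seq {set V} :=
  if g is x :: g' then pairmap (fun x y => [set x; y]) x g' else [::].

Lemma size_path_edges g : size (path_edges g) = (size g).-1.
Proof. by case: g => [//|x g]; rewrite /= size_pairmap. Qed.

Lemma path_edges_cat g x g' :
  path_edges (g ++ x :: g') = path_edges (rcons g x) ++ path_edges (x :: g').
Proof. by case: g => [//|y g]; rewrite -cat_rcons /= pairmap_cat last_rcons. Qed.

(** A 2-edge seen on the edges of the paths: going from [be] to [al], the triangle
    removes two consecutive edges and inserts the third one, or conversely.  The
    size comparison and the common prefix are the data by which [Phi] tells the
    kind of a move and its position. *)
Variant event al be t : Prop :=
| Contraction L1 L2 x y z of t = [set x; y; z]
    & [set x; y; z] \in triangles T & (size al < size be)%N = true
    & (common_prefix al be).-1 = size L1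
    & path_edges al = L1 ++ [set x; z] :: L2
    & path_edges be = L1 ++ [:: [set x; y], [set y; z] & L2]
| Expansion L1 L2 x y z of t = [set x; y; z]
    & [set x; y; z] \in triangles T & (size al < size be)%N = false
    & (common_prefix al be).-1 = size L1
    & path_edges al = L1 ++ [:: [set x; y], [set y; z] & L2]
    & path_edges be = L1 ++ [set x; z] :: L2.

Lemma sweeps_event al be t : sweeps al be t -> event al be t.
Proof.
have sizeE (g : seq V) x : size g = size (path_edges (rcons g x)).
  by rewrite size_path_edges size_rcons.
have insE (p q : seq V) x y z : [set x; y; z] \in triangles T ->
    let al := p ++ [:: x, z & q] in let be := p ++ [:: x, y, z & q] in
    [/\ (size al < size be)%N, (common_prefix al be).-1 = size (path_edges (rcons p x)),
      (common_prefix be al).-1 = size (path_edges (rcons p x)),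
      path_edges al = path_edges (rcons p x) ++ [set x; z] :: path_edges (z :: q)
      & path_edges be =
        path_edges (rcons p x) ++ [:: [set x; y], [set y; z] & path_edges (z :: q)]].
  move=> /triangleE[_ yz _] /=; rewrite !path_edges_cat -sizeE.
  rewrite eq_sym in yz; have [-> ->] := common_prefix_ins p q x yz.
  by rewrite !size_cat /= ltn_add2l ltnSn.
case=> _ _ [] [p [x [y [z [q [-> -> -> ht]]]]]];
  have [h1 h2 h3 h4 h5] := insE p q x y z ht.
  by apply: Contraction h4 h5.
by apply: Expansion h5 h4 => //; rewrite ltnNge ltnW.
Qed.

(** [Phi] and the lists of edges fix the position of the move, hence two edges of the
    triangle, which cover it. *)
Lemma event_inj al be t t' : event al be t -> event al be t' -> t = t'.
Proof.
have setE (x y z : V) : [set x; y; z] = [set x; y] :|: [set y; z].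
  by apply/setP=> v; rewrite !inE; case: (v == y); rewrite !(orbT, orbF).
case=> L1 L2 x y z -> _ size_lt j alE beE [] L1' L2' x' y' z' -> _ size_lt' j' alE' beE';
  (have {size_lt size_lt'} := etrans (esym size_lt) size_lt') => // _;
  rewrite setE [RHS]setE.
  have sz : size L1 = size L1' by rewrite -j -j'.
  by move/eqP: beE; rewrite beE' eqseq_cat // => /andP[_ /eqP[-> ->]].
have sz : size L1 = size L1' by rewrite -j -j'.
by move/eqP: alE; rewrite alE' eqseq_cat // => /andP[_ /eqP[-> ->]].
Qed.

Variables (a b : V) (Gamma : seq (seq V)).
Hypothesis ab_edge : [set a; b] \in edges T.
Hypothesis Gamma_loop : two_loop [:: a; b] Gamma.
Hypothesis Gamma_sweeps : sweeps_once Gamma.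

Local Notation n := (size Gamma).-1.
Local Notation ab := [set a; b].
Local Notation edges_at p := (path_edges (nth [::] Gamma p)).

Let Gamma_gt0 : (0 < size Gamma)%N.
Proof. by case: Gamma_loop => -[]; case: (Gamma). Qed.

Let edges_last : edges_at n = [:: ab].
Proof. by case: Gamma_loop => _ _; rewrite nth_last => ->. Qed.

Let edges_first : edges_at 0 = [:: ab].
Proof. by case: Gamma_loop => _ + _; rewrite nth0 => ->. Qed.

Definition swept p : {set V} :=
  odflt finset.set0 [pick t | `[< sweeps (nth [::] Gamma p) (nth [::] Gamma p.+1) t >]].

Lemma sweptP p : (p.+1 < size Gamma)%N ->
  sweeps (nth [::] Gamma p) (nth [::] Gamma p.+1) (swept p).
Proof.
case: Gamma_loop => -[_ _ h] _ _ /h[t ht]; rewrite /swept.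
by case: pickP => [t' /asboolP //|/(_ t) /asboolP].
Qed.

Lemma swept_triangle p : (p.+1 < size Gamma)%N -> swept p \in triangles T.
Proof. by move=> /sweptP/sweeps_event[] L1 L2 x y z ->. Qed.

Lemma swept_inj p q : (p.+1 < size Gamma)%N -> (q.+1 < size Gamma)%N ->
  swept p = swept q -> p = q.
Proof.
move=> hp hq pq; have [r [_ uniq_r]] := Gamma_sweeps (swept_triangle hp).
rewrite -(uniq_r p); last by split; [|exact: sweptP].
by apply: uniq_r; split; rewrite // pq; exact: sweptP.
Qed.

Lemma prod_swept (f : {set V} -> C) :
  \prod_(0 <= p < n) f (swept p) = \prod_(t in triangles T) f t.
Proof.
have ltn_size p : (p \in index_iota 0 n) -> (p.+1 < size Gamma)%N.
  by rewrite mem_index_iota; lia.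
rewrite -(big_map swept xpredT f) -[RHS]big_enum; apply: perm_big; apply: uniq_perm.
- rewrite map_inj_in_uniq ?iota_uniq // => p q /ltn_size hp /ltn_size hq.
  exact: swept_inj.
- exact: enum_uniq.
move=> t; rewrite mem_enum; apply/mapP/idP => [[p /ltn_size hp ->]|ht].
  exact: swept_triangle.
have [p [[hp swp] _]] := Gamma_sweeps ht; exists p.
  by rewrite mem_index_iota; lia.
exact: event_inj (sweeps_event swp) (sweeps_event (sweptP hp)).
Qed.

Lemma sum_swept_edge f : f \in edges T -> (\sum_(0 <= p < n) (f \subset swept p) <= 2)%N.
Proof.
move=> /card_edge_triangles; apply: leq_trans.
rewrite big_mkord -big_mkcond /= sum1dep_card -(@card_in_imset _ _ (fun p : 'I_n => swept p)).
  apply: subset_leq_card; apply/fintype.subsetP=> t /imsetP[p].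
  by rewrite !inE => fp ->; rewrite fp swept_triangle //; case: p {fp} => /= p; lia.
move=> p q _ _ /swept_inj pq; apply/val_inj/pq; have := (ltn_ord p, ltn_ord q);
  by case=> /=; lia.
Qed.

Definition mult p f := count_mem f (edges_at p).

Lemma mult_event p f : (p.+1 < size Gamma)%N ->
  (mult p f <= mult p.+1 f + (f \subset swept p))%N.
Proof.
move=> /sweptP/sweeps_event ev; rewrite /mult.
have sub (e : {set V}) t : e \subset t -> ((e == f) <= (f \subset t))%N.
  by case: eqP => // <- ->.
case: ev => L1 L2 x y z -> ht _ _ -> ->; rewrite !count_cat /=;
  have [xyT yzT xzT] := sub_triangle x y z; have [xy_yz _ _] := triangle_edges_neq ht;
  move: (sub _ _ xyT) (sub _ _ yzT) (sub _ _ xzT).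
  lia.
suff : (([set x; y] == f) + ([set y; z] == f) <= 1)%N by lia.
case: eqP => [<-|_]; last by case: (_ == f).
by rewrite eq_sym (negPf xy_yz).
Qed.

(** Going from [q] down to [p], an edge gains an occurrence only by sweeping a
    triangle which contains it. *)
Lemma mult_bound p q f : (p <= q < size Gamma)%N ->
  (mult p f <= mult q f + \sum_(p <= r < q) (f \subset swept r))%N.
Proof.
move=> /andP[]; elim: q => [|q IH]; first by rewrite leqn0 => /eqP->; rewrite leq_addr.
rewrite leq_eqVlt => /orP[/eqP->|pq] hq; first by rewrite leq_addr.
rewrite big_nat_recr //=; have := IH pq (ltnW hq); have := mult_event f hq; lia.
Qed.

(** The path (a, b) is too short to be contracted, so the base edge is consumed at
    once. *)
Lemma first_event : (0 < n)%N -> exists x y z,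
  [/\ swept n.-1 = [set x; y; z], [set x; z] = ab,
      (size (nth [::] Gamma n.-1) < size (nth [::] Gamma n))%N = false,
      (common_prefix (nth [::] Gamma n.-1) (nth [::] Gamma n)).-1 = 0%N
    & edges_at n.-1 = [:: [set x; y]; [set y; z]]].
Proof.
move=> n0; have hn : (n.-1.+1 < size Gamma)%N by lia.
have := sweeps_event (sweptP hn); rewrite prednK //.
case=> [] L1 L2 x y z -> _ size_lt j alE; rewrite edges_last => beE.
  by have := congr1 size beE; rewrite size_cat /= !addnS.
have L0 : L1 = [::] /\ L2 = [::].
  by have := congr1 size beE; rewrite size_cat /=; case: (L1); case: (L2) => //= *; lia.
exists x, y, z; case: L0 beE alE j => -> -> [<-] -> ->; by split.
Qed.

(** The 2-loop is run from its end, so the events still to come are those of index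
    less than [p].  To leave the path at [p], the edge must have entered it before;
    these two events use up the at most two triangles containing the edge, and
    nothing happens to it afterwards.  The last hypothesis excludes the first event
    on the base edge, which is on the path from the start. *)
Lemma dying_edge p f : (p.+1 < size Gamma)%N -> f \in edges T -> f \subset swept p ->
  (mult p f < mult p.+1 f)%N -> (p.+1 < n)%N || (f != ab) ->
  [/\ f \notin edges_at p, f != ab & forall q, (q < p)%N -> ~~ (f \subset swept q)].
Proof.
move=> hp hf fp dies not_base.
have total : (\sum_(0 <= q < p) (f \subset swept q) + 1 +
    \sum_(p.+1 <= q < n) (f \subset swept q) <= 2)%N.
  have := sum_swept_edge hf; rewrite (@big_cat_nat _ _ _ p) /=; try lia.
  by rewrite (@big_ltn _ _ _ p) ?fp ?addnA //; lia.
(* the base edge would lie in three triangles: that of the first event, that of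
   the event p, and one in between which brought it back on the path *)
have fab : f != ab.
  apply/eqP=> fE; subst f; rewrite eqxx orbF in not_base.
  have [|x [y [z [tE acE _ _ edgesE]]]] := first_event; first by lia.
  have tT : [set x; y; z] \in triangles T by rewrite -tE; apply: swept_triangle; lia.
  have : mult n.-1 ab = 0%N.
    have [_ /negPf xy_xz /negPf yz_xz] := triangle_edges_neq tT.
    by rewrite /mult edgesE -acE /= xy_xz yz_xz.
  have ab_last : ab \subset swept n.-1.
    by have [_ _] := sub_triangle x y z; rewrite acE -tE.
  have last_term : (\sum_(p.+1 <= r < n) (ab \subset swept r) =
      \sum_(p.+1 <= r < n.-1) (ab \subset swept r) + 1)%N.
    have nE : n = n.-1.+1 by lia.
    by rewrite [in LHS]nE big_nat_recr /= ?ab_last //; lia.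
  have := @mult_bound p.+1 n.-1 ab; lia.
have := @mult_bound p.+1 n f; rewrite {2}/mult edges_last /= eq_sym (negPf fab) => bound.
split=> //.
  rewrite -has_pred1 has_count -/(mult p f); lia.
move=> q qp; apply/negP=> fq; move: total.
rewrite (@big_cat_nat _ _ _ q) /=; try lia.
rewrite (@big_ltn _ _ _ q) // fq; lia.
Qed.

(** * The chromatic index as a state sum *)

Section StateSum.
Variable s : C.
Hypothesis s_neq0 : s != 0.

(** The events from [p] on are evaluated by [amp], starting from the base edge
    with the colour which [u] gives it. *)
Definition later p (u : colouring) : C :=
  amp s (delta C (colour u ab)) Gamma p (map (colour u) (edges_at p)).

Definition earlier p (u : colouring) : C := \prod_(0 <= q < p) weight (swept q) u.

Lemma earlier_recolour p f c u : (p < size Gamma)%N -> f \in edges T ->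
  (forall q, (q < p)%N -> ~~ (f \subset swept q)) ->
  earlier p (recolour u f c) = earlier p u.
Proof.
move=> hp hf h; rewrite /earlier !big_nat; apply: eq_bigr => q /andP[_ qp].
apply: weight_recolour => //; last exact: h.
by apply: swept_triangle; apply: leq_ltn_trans hp.
Qed.

Lemma amp_contraction p (A : seq 'I_3 -> C^o) w1 c0 w2 :
  (p.+1 < size Gamma)%N ->
  (size (nth [::] Gamma p) < size (nth [::] Gamma p.+1))%N = true ->
  (common_prefix (nth [::] Gamma p) (nth [::] Gamma p.+1)).-1 = size w1 ->
  amp s A Gamma p (w1 ++ c0 :: w2) =
    \sum_c \sum_d (s * ('i * eps C c d c0)) * amp s A Gamma p.+1 (w1 ++ [:: c, d & w2]).
Proof. by move=> hp sz j; rewrite amp_step // /transfer sz j at_pos_cat. Qed.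

Lemma amp_expansion p (A : seq 'I_3 -> C^o) w1 c d w2 :
  (p.+1 < size Gamma)%N ->
  (size (nth [::] Gamma p) < size (nth [::] Gamma p.+1))%N = false ->
  (common_prefix (nth [::] Gamma p) (nth [::] Gamma p.+1)).-1 = size w1 ->
  amp s A Gamma p (w1 ++ [:: c, d & w2]) =
    \sum_c0 (- (s * ('i * eps C c d c0))) * amp s A Gamma p.+1 (w1 ++ c0 :: w2).
Proof. by move=> hp sz j; rewrite amp_step // /transfer sz j at_pos_cat. Qed.

(** The edges [xy] and [yz] die: summing over their colours is integrating them out,
    since they occur neither elsewhere on the path nor in the triangles still to
    be swept. *)
Lemma contraction_step p L1 L2 x y z : (p.+1 < size Gamma)%N ->
  swept p = [set x; y; z] -> [set x; y; z] \in triangles T ->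
  (size (nth [::] Gamma p) < size (nth [::] Gamma p.+1))%N = true ->
  (common_prefix (nth [::] Gamma p) (nth [::] Gamma p.+1)).-1 = size L1 ->
  edges_at p = L1 ++ [set x; z] :: L2 ->
  edges_at p.+1 = L1 ++ [:: [set x; y], [set y; z] & L2] ->
  exists2 k : C, k != 0 &
    \sum_u earlier p u * later p u = k * \sum_u earlier p.+1 u * later p.+1 u.
Proof.
move=> hp tE tT sz j alE beE; have [k k0 kE] := weightE tT.
have [xyT yzT xzT] := triangle_edges tT.
have [xys yzs _] := sub_triangle x y z; have [e12 e13 e23] := triangle_edges_neq tT.
rewrite -tE in xys yzs kE.
set e1 := [set x; y] in xyT xys e12 e13 alE beE kE *.
set e2 := [set y; z] in yzT yzs e12 e23 alE beE kE *.
set e3 := [set x; z] in xzT e13 e23 alE beE kE *.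
(* the end (a, b) of the 2-loop has a single edge *)
have pn : (p.+1 < n)%N.
  rewrite ltn_neqAle -[(_ <= n)%N]ltnS prednK // hp andbT; apply/eqP=> pn.
  by have := congr1 size edges_last; rewrite -pn beE size_cat /= !addnS.
have dies f : (f == e1) || (f == e2) -> (mult p f < mult p.+1 f)%N.
  rewrite /mult alE beE !count_cat /=.
  by case/orP=> /eqP->; rewrite eqxx !(eq_sym e3) ?(eq_sym e2 e1)
    ?(negPf e12) ?(negPf e13) ?(negPf e23) ltn_add2l; exact: ltnSn.
have [||e1L e1ab e1q] := dying_edge hp xyT xys; rewrite ?dies ?eqxx ?pn //.
have [||e2L e2ab e2q] := dying_edge hp yzT yzs; rewrite ?dies ?eqxx ?orbT ?pn //.
pose H u := earlier p u * (s * (k * weight (swept p) u)) * later p.+1 u.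
exists (3%:R * (3%:R * (s * k))); first by rewrite !mulf_neq0 ?pnatr_eq0.
transitivity (\sum_u \sum_c \sum_d H (recolour (recolour u e1 c) e2 d)).
  apply: eq_bigr => u _; rewrite /later alE map_cat /=.
  rewrite amp_contraction ?size_map // mulr_sumr; apply: eq_bigr => c _.
  rewrite mulr_sumr; apply: eq_bigr => d _.
  move: e1L e2L; rewrite alE !mem_cat !inE !negb_or.
  move=> /and3P[e1L1 _ e1L2] /and3P[e2L1 _ e2L2].
  rewrite /H /later -kE beE map_cat /= !earlier_recolour ?(ltnW hp) //.
  rewrite !map_colour_recolour // !colour_recolour // !eqxx !(eq_sym ab) !(eq_sym e3).
  rewrite (negPf e12) (negPf e13) (negPf e23) (negPf e1ab) (negPf e2ab).
  by rewrite !mulrA.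
rewrite (@sum_recolour _ _ e1 (fun u => \sum_d H (recolour u e2 d))) //.
rewrite sum_recolour // /H -!mulrA; congr (_ * (_ * _)).
rewrite !mulr_sumr; apply: eq_bigr => u _.
by rewrite /earlier big_nat_recr //=; ring.
Qed.

(** The edge [xz] dies, unless it is the base edge at the first event.  In that case
    there is nothing to integrate: the sum over the colour of the base edge
    is already reduced to one term by [delta]. *)
Lemma expansion_step p L1 L2 x y z : (p.+1 < size Gamma)%N ->
  swept p = [set x; y; z] -> [set x; y; z] \in triangles T ->
  (size (nth [::] Gamma p) < size (nth [::] Gamma p.+1))%N = false ->
  (common_prefix (nth [::] Gamma p) (nth [::] Gamma p.+1)).-1 = size L1 ->
  edges_at p = L1 ++ [:: [set x; y], [set y; z] & L2] ->
  edges_at p.+1 = L1 ++ [set x; z] :: L2 ->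
  exists2 k : C, k != 0 &
    \sum_u earlier p u * later p u = k * \sum_u earlier p.+1 u * later p.+1 u.
Proof.
move=> hp tE tT sz j alE beE; have [k k0 kE] := weightE tT.
have [_ _ xzT] := triangle_edges tT.
have [_ _ xzs] := sub_triangle x y z; have [_ e13 e23] := triangle_edges_neq tT.
rewrite -tE in xzs kE.
set e1 := [set x; y] in e13 alE beE kE *; set e2 := [set y; z] in e23 alE beE kE *.
set e3 := [set x; z] in xzT xzs e13 e23 alE beE kE *.
case: (boolP (p.+1 == n)) => [/eqP pn|pn].
  exists (- (s * k)); first by rewrite oppr_eq0 mulf_neq0.
  move: beE; rewrite pn edges_last => beE.
  have [L10 L20] : L1 = [::] /\ L2 = [::].
    by case: (L1) beE => [[_ ->]|? []].
  subst L1 L2; case: beE => e3E; rewrite mulr_sumr; apply: eq_bigr => u _.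
  rewrite /later alE -pn.
  have := @amp_expansion p (delta C (colour u ab)) [::] (colour u e1) (colour u e2) [::] hp sz j.
  rewrite /= pn amp_last edges_last /= => ->.
  rewrite (bigD1 (colour u ab)) //= big1 => [|c cab]; last first.
    by rewrite /delta eqseq_cons (negPf cab) mulr0.
  rewrite /delta eqxx /= addr0 {1}e3E kE.
  by rewrite -pn /earlier big_nat_recr //=; ring.
have {}pn : (p.+1 < n)%N by rewrite ltn_neqAle pn -[(_ <= n)%N]ltnS prednK.
have dies : (mult p e3 < mult p.+1 e3)%N.
  rewrite /mult alE beE !count_cat /= eqxx (negPf e13) (negPf e23) ltn_add2l.
  exact: ltnSn.
have [|e3L e3ab e3q] := dying_edge hp xzT xzs dies; first by rewrite pn.
pose H u := earlier p u * (- (s * (k * weight (swept p) u))) * later p.+1 u.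
exists (3%:R * - (s * k)); first by rewrite !(mulf_neq0, oppr_eq0) ?pnatr_eq0.
transitivity (\sum_u \sum_c H (recolour u e3 c)).
  apply: eq_bigr => u _; rewrite /later alE map_cat /=.
  rewrite amp_expansion ?size_map // mulr_sumr; apply: eq_bigr => c _.
  move: e3L; rewrite alE !mem_cat !inE !negb_or => /and4P[e3L1 _ _ e3L2].
  rewrite /H /later -kE beE map_cat /= !earlier_recolour ?(ltnW hp) //.
  rewrite !map_colour_recolour // !colour_recolour //.
  rewrite !eqxx !(eq_sym ab) (negPf e13) (negPf e23) (negPf e3ab).
  by rewrite !mulrA.
rewrite sum_recolour // /H -!mulrA; congr (_ * _).
rewrite !mulr_sumr; apply: eq_bigr => u _.
by rewrite /earlier big_nat_recr //=; ring.
Qed.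

Lemma state_sum_step p : (p.+1 < size Gamma)%N -> exists2 k : C, k != 0 &
  \sum_u earlier p u * later p u = k * \sum_u earlier p.+1 u * later p.+1 u.
Proof.
move=> hp; have := sweeps_event (sweptP hp).
by case=> L1 L2 x y z tE tT sz j alE beE;
  [apply: contraction_step tE tT sz j alE beE|apply: expansion_step tE tT sz j alE beE].
Qed.

Lemma state_sum p : (p < size Gamma)%N -> exists2 k : C, k != 0 &
  \sum_u later 0 u = k * \sum_u earlier p u * later p u.
Proof.
elim: p => [_|p IH hp].
  exists 1; rewrite ?oner_neq0 // mul1r; apply: eq_bigr => u _.
  by rewrite /earlier big_geq // mul1r.
have [k k0 ->] := IH (ltnW hp); have [k' k'0 ->] := state_sum_step hp.
by exists (k * k'); rewrite ?mulrA ?mulf_neq0.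
Qed.

(** The state sum at the end of the 2-loop is the chromatic index.  At its beginning
    all terms equal the same diagonal coefficient, so nothing cancels. *)
Lemma amp_loop_eq0 : (amp s (delta C 0) Gamma 0 [:: 0] == 0) = (chromatic_index T == 0).
Proof.
have [|k k0] := @state_sum n; first by rewrite prednK.
have -> : \sum_u earlier n u * later n u = chromatic_index T.
  rewrite chromatic_indexE; apply: eq_bigr => u _.
  rewrite /earlier (prod_swept (fun t => weight t u)).
  by rewrite /later amp_last edges_last /= /delta eqxx mulr1.
rewrite (eq_bigr (fun=> amp s (delta C 0) Gamma 0 [:: 0])) => [|u _]; last first.
  by rewrite /later edges_first /= amp_diag.
rewrite sumr_const -mulr_natl => /(congr1 (eq_op^~ 0)); rewrite !mulf_eq0 (negPf k0) /= => <-.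
have : #|colouring|%:R != 0 :> C.
  by rewrite pnatr_eq0 -lt0n; apply/card_gt0P; exists [ffun=> 0].
by move=> /negPf->.
Qed.

End StateSum.

(** * The connection of the global section *)

Lemma zeta_step p : (p.+1 < size Gamma)%N ->
  zeta C Gamma p = Phi (nth [::] Gamma p) (nth [::] Gamma p.+1) (zeta C Gamma p.+1).
Proof.
move=> h; rewrite /zeta (drop_nth [::] (ltnW h)) /=.
by rewrite (drop_nth [::] h).
Qed.

Lemma zeta_last : zeta C Gamma n = base_section C.
Proof.
rewrite /zeta; case: Gamma => [//|g G].
by rewrite (drop_nth [::]) //= drop_size.
Qed.

(** The rules for coefficients need the position of the move to lie inside the path;
    the number of edges of the path guarantees it. *)
Lemma zeta_coef p : (p < size Gamma)%N ->
  (forall E w m, down_coef E (zeta C Gamma p) w m =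
     amp 1 (fun v => down_coef E (base_section C) v m) Gamma p w) /\
  (forall E w x, up_coef E (zeta C Gamma p) w x =
     amp (-1) (fun v => up_coef E (base_section C) v x) Gamma p w).
Proof.
move: p; apply: backward_ind.
  by split=> E w m; rewrite zeta_last amp_last.
move=> p hp [IHd IHu].
have lenP : (plength (zeta C Gamma p.+1)).+1 = size (nth [::] Gamma p.+1).
  exact: zeta_over Gamma_loop hp.
have [bound_merge bound_split] :
    ((size (nth [::] Gamma p) < size (nth [::] Gamma p.+1))%N = true ->
       ((common_prefix (nth [::] Gamma p) (nth [::] Gamma p.+1)).-1.+1 <
        plength (zeta C Gamma p.+1))%N) /\
    ((size (nth [::] Gamma p) < size (nth [::] Gamma p.+1))%N = false ->
       ((common_prefix (nth [::] Gamma p) (nth [::] Gamma p.+1)).-1 <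
        plength (zeta C Gamma p.+1))%N).
  have -> : plength (zeta C Gamma p.+1) = size (path_edges (nth [::] Gamma p.+1)).
    by rewrite size_path_edges -lenP.
  case: Gamma_loop => -[_ _ /(_ p hp)[t /sweeps_event ev]] _ _.
  by case: ev => L1 L2 x y z _ _ -> -> _ ->; split=> // _;
    rewrite size_cat /= !addnS ?ltnS leq_addr.
rewrite zeta_step //.
split=> E w m; rewrite amp_step // /transfer /Phi.
  rewrite -(funext (fun v => IHd E v m)); case: ifP => [/bound_merge|/bound_split] h.
    by rewrite down_coef_contract.
  by rewrite down_coef_expand.
rewrite -(funext (fun v => IHu E v m)); case: ifP => [/bound_merge|/bound_split] h.
  by rewrite up_coef_contract.
by rewrite up_coef_expand.
Qed.

Lemma nonvanishing_iff :
  chromatic_index T <> 0 <->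
  (forall p, (p < size Gamma)%N -> nonvanishing (zeta C Gamma p)).
Proof.
have n1 : (-1 : C) != 0 by rewrite oppr_eq0 oner_neq0.
split=> [/eqP K0 p hp|].
  have [hd hu] := zeta_coef hp.
  have exists_word (W : lmodType C) s (A : seq 'I_3 -> W) d : s != 0 ->
      (forall w, size w != 1%N -> A w = 0) -> A [:: d] != 0 ->
      exists w, amp s A Gamma p w != 0.
    move=> s0 A1 Ad; apply: contrapT => none.
    have {}none w : amp s A Gamma p w = 0.
      by apply: contrapT => /eqP nz; apply: none; exists w.
    have := amp0 hp none [:: d]; rewrite amp_scalar // => /eqP.
    by rewrite scaler_eq0 amp_loop_eq0 // (negPf K0) (negPf Ad).
  have [w hw] := exists_word _ _ _ _ (oner_neq0 C)
    (fun w => @down_coef_base C _ w _) (down_coef_base_neq0 C).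
  have [w' hw'] := exists_word _ _ _ _ n1
    (fun w => @up_coef_base C _ w _) (up_coef_base_neq0 C).
  by apply: (nonvanishing_coef (w := w) (w' := w')); rewrite ?hd ?hu; [exact: hw|exact: hw'].
move=> /(_ 0%N Gamma_gt0) /single_edge_coef; have := zeta_over C Gamma_loop Gamma_gt0.
case: (Gamma_loop) => _ + _; rewrite -nth0 => -> [len1] /(_ len1) [E [d [m]]].
have [-> _] := zeta_coef Gamma_gt0; rewrite amp_scalar; last by move=> w; apply: down_coef_base.
by rewrite scaler_eq0 amp_loop_eq0 ?oner_neq0 // negb_or => /andP[/eqP].
Qed.

End Sweeping.

Theorem theorem4 (R : realType)
    (a b : forall T : triangulation R, vertex T)
    (Gamma : forall T : triangulation R, seq (seq (vertex T)))
    (base_edge : forall T, [set a T; b T] \in edges T)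
    (Gamma_loop : forall T, two_loop [:: a T; b T] (Gamma T))
    (Gamma_sweeps : forall T, sweeps_once (Gamma T)) :
  (forall T : triangulation R, chromatic_index T <> 0) <->
  (forall (T : triangulation R) (p : nat), (p < size (Gamma T))%N ->
     nonvanishing (zeta R[i] (Gamma T) p)).
Proof.
have key T := nonvanishing_iff (base_edge T) (Gamma_loop T) (@Gamma_sweeps T).
by split=> h T; apply/key; apply: h.
Qed.
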